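(* Let $G$ be a finite group with a representation $\rho_0$ on $\mathbb{R}^{d_0}$, and let $S=\{(\mathbf{x}_i,y_i): i\in[n]\}$ with $\mathbf{x}_i\in\mathbb{R}^{d_0}$, $y_i\in\{\pm1\}$. Consider an $L$-layer linear steerable network $f_{\mathrm{steer}}(\mathbf{x};\mathbf{W})=\langle \mathbf{x},\mathcal{P}_{\mathrm{steer}}(\mathbf{W})\rangle$ whose first layer is the $G$-lifting map into the regular representation, with all other hidden representations and chosen intertwiners arbitrary, as defined in the context. Let $\{\mathbf{W}(t)\}_{t\ge0}$ be the gradient flow of the exponential loss $\mathcal{L}_{\mathcal{P}_{\mathrm{steer}}}(\cdot;S)$ from some initialization, and assume $\mathcal{L}_{\mathcal{P}_{\mathrm{steer}}}(\mathbf{W}(t_0);S)<1$ for some $t_0>0$. Put $\boldsymbol\beta_{\mathrm{steer}}(t)=\mathcal{P}_{\mathrm{steer}}(\mathbf{W}(t))$. Then: (a) The directional limit $\boldsymbol\beta_{\mathrm{steer}}^\infty=\lim_{t\to\infty}\frac{\boldsymbol\beta_{\mathrm{steer}}(t)}{\|\boldsymbol\beta_{\mathrm{steer}}(t)\|}$ exists, and $\boldsymbol\beta_{\mathrm{steer}}^\infty\propto\frac{1}{|G|}\sum_{g\in G}\rho_0(g)^\top\boldsymbol\gamma^*$, where $\boldsymbol\gamma^*$ is the max-$L^2$-margin SVM solution for the transformed data $\overline S=\{(\overline{\mathbf{x}}_i,y_i): i\in[n]\}$: $$\boldsymbol\gamma^*=\arg\min_{\boldsymbol\gamma\in\mathbb{R}^{d_0}}\|\boldsymbol\gamma\|^2\quad\text{s.t.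 } y_i\langle\overline{\mathbf{x}}_i,\boldsymbol\gamma\rangle\ge1,\ \forall i\in[n].$$ Furthermore, if $\rho_0$ is unitary, i.e. $\rho_0(g^{-1})=\rho_0(g)^\top$ for all $g\in G$, then $\boldsymbol\beta_{\mathrm{steer}}^\infty\propto\boldsymbol\gamma^*$. (b) Equivalently, $\boldsymbol\beta_{\mathrm{steer}}^\infty$ is proportional to the unique minimizer $\boldsymbol\beta^*$ of the problem $$\boldsymbol\beta^*=\arg\min_{\boldsymbol\beta\in\mathbb{R}^{d_0}}\|\mathrm{Proj}_{\mathrm{Range}(\mathcal{A})}\boldsymbol\beta\|^2\quad\text{s.t. }\boldsymbol\beta\in\mathbb{R}^{d_0}_G\text{ and } y_i\langle\mathbf{x}_i,\boldsymbol\beta\rangle\ge1,\ \forall i\in[n],$$ where $\mathcal{A}=\frac{1}{|G|}\sum_{g\in G}\rho_0(g)$ and $\mathrm{Proj}_{\mathrm{Range}(\mathcal{A})}$ is the orthogonal projection of $\mathbb{R}^{d_0}$ onto $\mathrm{Range}(\mathcal{A})$. Moreover, if $\rho_0$ is unitary, then $$\boldsymbol\beta_{\mathrm{steer}}^\infty\propto\boldsymbol\beta^*=\arg\min_{\boldsymbol\beta\in\mathbb{R}^{d_0}}\|\boldsymbol\beta\|^2\quad\text{s.t. }\boldsymbol\beta\in\mathbb{R}^{d_0}_G\text{ and } y_i\langle\mathbf{x}_i,\boldsymbol\beta\rangle\ge1,\ \forall i\in[n];$$ namely, $\boldsymbol\beta_{\mathrm{steer}}^\infty$ achieves the maximum $L^2$-margin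 among all $G$-invariant linear predictors.
   Context: Notation. $[n]=\{1,\dots,n\}$; $\langle\cdot,\cdot\rangle$ and $\|\cdot\|$ are the Euclidean inner product and norm; $\mathbf{u}\propto\mathbf{v}$ means $\mathbf{u}=c\mathbf{v}$ for some scalar $c>0$. $G$ is a finite group, $\rho_0:G\to GL(\mathbb{R}^{d_0})$ a representation, $g\mathbf{x}:=\rho_0(g)\mathbf{x}$, and $\overline{\mathbf{x}}:=\frac1{|G|}\sum_{g\in G}\rho_0(g)\mathbf{x}$. The space of $G$-invariant linear predictors is $\mathbb{R}^{d_0}_G=\{\boldsymbol\beta\in\mathbb{R}^{d_0}:\boldsymbol\beta^\top\mathbf{x}=\boldsymbol\beta^\top\rho_0(g)\mathbf{x}\ \forall\mathbf{x}\in\mathbb{R}^{d_0},\forall g\in G\}$. Linear steerable network. Let $L\ge2$. Given finite-dimensional real representations $(\mathcal{X}_l,\rho_l)$ of $G$, $l=0,\dots,L$, with $(\mathcal{X}_0,\rho_0)=(\mathbb{R}^{d_0},\rho_0)$, $(\mathcal{X}_L,\rho_L)=(\mathbb{R},\text{trivial})$, and $(\mathcal{X}_1,\rho_1)$ the regular representation $\mathcal{X}_1=\{\mathbf{x}_1:G\to\mathbb{R}^{d_1}\}$, $(\rho_1(g)\mathbf{x}_1)(h)=\mathbf{x}_1(g^{-1}h)$; the representations $(\mathcal{X}_l,\rho_l)$ for $2\le l\le L-1$ are arbitrary. The first layer is the $G$-lifting map $\Psi_1(\mathbf{x};\mathbf{w}_1)(g)=\mathbf{w}_1^\top\rho_0(g)^{-1}\mathbf{x}\in\mathbb{R}^{d_1}$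 with trainable $\mathbf{w}_1\in\mathbb{R}^{d_0\times d_1}$. For $2\le l\le L$, one fixes a finite collection of $G$-equivariant linear maps (intertwiners) $\psi_l^1,\dots,\psi_l^{N_l}:\mathcal{X}_{l-1}\to\mathcal{X}_l$ (not necessarily a basis of all intertwiners) and sets $\Psi_l(\mathbf{x};\mathbf{w}_l)=\sum_{j=1}^{N_l}w_l^j\psi_l^j(\mathbf{x})$ with trainable $\mathbf{w}_l\in\mathbb{R}^{N_l}$. The network is $f_{\mathrm{steer}}(\mathbf{x};\mathbf{W})=\Psi_L(\cdots\Psi_2(\Psi_1(\mathbf{x};\mathbf{w}_1);\mathbf{w}_2)\cdots;\mathbf{w}_L)$, with $\mathbf{W}=(\mathbf{w}_1,\dots,\mathbf{w}_L)\in\mathcal{W}_{\mathrm{steer}}=\mathbb{R}^{d_0\times d_1}\times\prod_{l=2}^L\mathbb{R}^{N_l}$. For each $\mathbf{W}$ it is linear in $\mathbf{x}$, and $\mathcal{P}_{\mathrm{steer}}(\mathbf{W})\in\mathbb{R}^{d_0}$ denotes the vector with $f_{\mathrm{steer}}(\mathbf{x};\mathbf{W})=\langle\mathbf{x},\mathcal{P}_{\mathrm{steer}}(\mathbf{W})\rangle$ for all $\mathbf{x}$. Gradient flow. With $\ell_{\exp}(\hat y,y)=\exp(-\hat yy)$, let $\mathcal{L}_{\mathcal{P}_{\mathrm{steer}}}(\mathbf{W};S)=\sum_{i=1}^n\ell_{\exp}(\langle\mathbf{x}_i,\mathcal{P}_{\mathrm{steer}}(\mathbf{W})\rangle,y_i)$.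 The gradient flow from $\mathbf{W}(0)\in\mathcal{W}_{\mathrm{steer}}$ is the solution $\{\mathbf{W}(t)\}_{t\ge0}$ of $\frac{d\mathbf{W}}{dt}=-\nabla_{\mathbf{W}}\mathcal{L}_{\mathcal{P}_{\mathrm{steer}}}(\mathbf{W};S)$. *)

(* Defs.v *)
From HB Require Import structures.
From mathcomp Require Import all_boot all_order all_algebra all_fingroup.
From mathcomp Require Import mxrepresentation.
From mathcomp Require Import all_classical all_reals all_analysis.
Import Order.TTheory GRing.Theory Num.Theory.
Import numFieldNormedType.Exports.

Set Implicit Arguments.
Unset Strict Implicit.
Unset Printing Implicit Defensive.

Local Open Scope classical_set_scope.
Local Open Scope ring_scope.

(* The Euclidean norm is introduced here because the library norm `|_| on
   matrices is the sup norm. Vectors of R^d are columns. *)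
Definition dotv (R : realType) (d : nat) (u v : 'cV[R]_d) : R :=
  \sum_(i < d) u i 0 * v i 0.

Definition norm2 (R : realType) (d : nat) (u : 'cV[R]_d) : R :=
  Num.sqrt (dotv u u).

Definition propto (R : realType) (d : nat) (u v : 'cV[R]_d) : Prop :=
  exists2 c : R, 0 < c & u = c *: v.

Definition is_argmin (R : realType) (T : Type) (f : T -> R) (C : set T)
    (x : T) : Prop :=
  C x /\ forall y, C y -> f x <= f y.

Definition is_unique_argmin (R : realType) (T : Type) (f : T -> R) (C : set T)
    (x : T) : Prop :=
  is_argmin f C x /\ forall y, is_argmin f C y -> y = x.

(* mx_representation contains the multiplicativity of rho0, which makes
   x |-> rho0 g *m x a left action on columns as well. *)
Definition unitary_repr (R : realType) (gT : finGroupType) (d : nat)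
    (rho0 : mx_representation R [set: gT]%SET d) : Prop :=
  forall g, rho0 (g^-1)%g = (rho0 g)^T.

Definition group_avg (R : realType) (gT : finGroupType) (d : nat)
    (rho0 : mx_representation R [set: gT]%SET d) : 'M[R]_d :=
  (#|gT|%:R)^-1 *: \sum_(g : gT) rho0 g.

Definition avg_vec (R : realType) (gT : finGroupType) (d : nat)
    (rho0 : mx_representation R [set: gT]%SET d) (x : 'cV[R]_d) : 'cV[R]_d :=
  (#|gT|%:R)^-1 *: \sum_(g : gT) rho0 g *m x.

Definition avg_tr_vec (R : realType) (gT : finGroupType) (d : nat)
    (rho0 : mx_representation R [set: gT]%SET d) (x : 'cV[R]_d) : 'cV[R]_d :=
  (#|gT|%:R)^-1 *: \sum_(g : gT) (rho0 g)^T *m x.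

Definition invariant_predictors (R : realType) (gT : finGroupType) (d : nat)
    (rho0 : mx_representation R [set: gT]%SET d) : set 'cV[R]_d :=
  [set b | forall (x : 'cV[R]_d) (g : gT), dotv b x = dotv b (rho0 g *m x)].

(* Orthogonal projection onto the column space of A. In row form this is the
   projection onto the row space of A^T along kermx A, the space of the rows
   u with u *m A = 0, i.e. the orthogonal complement of the columns of A;
   orth_proj_range_unique says that the formula is the intended one. *)
Definition orth_proj_range (R : realType) (d : nat) (A : 'M[R]_d)
    (u : 'cV[R]_d) : 'cV[R]_d :=
  (u^T *m proj_mx A^T (kermx A))^T.

Definition feasible (R : realType) (d n : nat) (x : 'I_n -> 'cV[R]_d)
    (y : 'I_n -> R) : set 'cV[R]_d :=
  [set b | forall i, 1 <= y i * dotv (x i) b].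

(* The infimum is a minimum when n > 0. *)
Definition l2_margin (R : realType) (d n : nat) (x : 'I_n -> 'cV[R]_d)
    (y : 'I_n -> R) (b : 'cV[R]_d) : R :=
  inf [set y i * dotv (x i) b / norm2 b | i in [set: 'I_n]].

Record lin_rep (R : realType) (gT : finGroupType) := LinRep {
  rep_space : vectType R;
  rep_act : gT -> rep_space -> rep_space;
  rep_act_linear : forall g, linear (rep_act g);
  rep_act1 : forall x, rep_act 1%g x = x;
  rep_actM : forall g h x, rep_act (g * h)%g x = rep_act g (rep_act h x) }.

Record intertwiner (R : realType) (gT : finGroupType) (X Y : lin_rep R gT) :=
  Intertwiner {
  intertwiner_map :> {linear rep_space X -> rep_space Y};
  intertwinerP : forall g x,
    intertwiner_map (rep_act g x) = rep_act g (intertwiner_map x) }.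

Definition regular_act (R : realType) (gT : finGroupType) (d1 : nat) (g : gT)
    (f : {ffun gT -> 'cV[R]_d1}) : {ffun gT -> 'cV[R]_d1} :=
  [ffun h => f (g^-1 * h)%g].

Lemma regular_act_linear (R : realType) (gT : finGroupType) (d1 : nat)
  (g : gT) : linear (@regular_act R gT d1 g).
Proof. by move=> a u v; apply/ffunP => h; rewrite !ffunE. Qed.

Lemma regular_act1 (R : realType) (gT : finGroupType) (d1 : nat)
  (f : {ffun gT -> 'cV[R]_d1}) : regular_act 1%g f = f.
Proof. by apply/ffunP => h; rewrite ffunE invg1 mul1g. Qed.

Lemma regular_actM (R : realType) (gT : finGroupType) (d1 : nat) (g h : gT)
  (f : {ffun gT -> 'cV[R]_d1}) :
  regular_act (g * h)%g f = regular_act g (regular_act h f).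
Proof. by apply/ffunP => k; rewrite !ffunE invMg mulgA. Qed.

Definition regular_rep (R : realType) (gT : finGroupType) (d1 : nat) :
    lin_rep R gT :=
  @LinRep R gT {ffun gT -> 'cV[R]_d1} (@regular_act R gT d1)
    (@regular_act_linear R gT d1) (@regular_act1 R gT d1)
    (@regular_actM R gT d1).

Definition trivial_rep (R : realType) (gT : finGroupType) : lin_rep R gT :=
  @LinRep R gT R^o (fun _ x => x) (fun _ _ _ _ => erefl) (fun _ => erefl)
    (fun _ _ _ => erefl).

(* upper_layers k X is the type of the architectures made of k >= 1 layers,
   each a finite family of intertwiners, leading from X to the trivial
   representation: for X = X_1 and k = L - 1 these are the families psi_l^j,
   j < N_l, 2 <= l <= L, together with the representations X_2, .., X_(L-1). *)
Inductive upper_layers (R : realType) (gT : finGroupType) :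
    nat -> lin_rep R gT -> Type :=
| LastLayer (X : lin_rep R gT) (N : nat)
    (psi : 'I_N -> intertwiner X (trivial_rep R gT)) : upper_layers 1 X
| HiddenLayer (k : nat) (X Y : lin_rep R gT) (N : nat)
    (psi : 'I_N -> intertwiner X Y) (net : upper_layers k Y) :
    upper_layers k.+1 X.

(* Index set of the weights w_l^j, 2 <= l <= L, 1 <= j <= N_l. *)
Fixpoint weight_idx (R : realType) (gT : finGroupType) (k : nat)
    (X : lin_rep R gT) (net : upper_layers k X) : finType :=
  match net with
  | LastLayer _ N _ => 'I_N
  | HiddenLayer _ _ _ N _ net' => ('I_N + weight_idx net')%type
  end.

Fixpoint upper_eval (R : realType) (gT : finGroupType) (k : nat)
    (X : lin_rep R gT) (net : upper_layers k X) :
    (weight_idx net -> R) -> rep_space X -> R :=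
  match net in upper_layers k X
    return (weight_idx net -> R) -> rep_space X -> R with
  | LastLayer _ N psi => fun w x => \sum_(j < N) w j * psi j x
  | HiddenLayer _ _ _ N psi net' => fun w x =>
      upper_eval (w \o inr) (\sum_(j < N) w (inl j) *: psi j x)
  end.

Definition lifting (R : realType) (gT : finGroupType) (d0 d1 : nat)
    (rho0 : mx_representation R [set: gT]%SET d0) (w1 : 'M[R]_(d0, d1))
    (x : 'cV[R]_d0) : {ffun gT -> 'cV[R]_d1} :=
  [ffun g => w1^T *m (invmx (rho0 g) *m x)].

(* Index set of all real parameters; a point of W_steer is a function from it
   to R, the left summand indexing the entries of w_1. *)
Definition param_idx (R : realType) (gT : finGroupType) (d0 d1 k : nat)
    (net : upper_layers k (regular_rep R gT d1)) : finType :=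
  ('I_d0 * 'I_d1 + weight_idx net)%type.

Definition f_steer (R : realType) (gT : finGroupType) (d0 d1 k : nat)
    (rho0 : mx_representation R [set: gT]%SET d0)
    (net : upper_layers k (regular_rep R gT d1))
    (x : 'cV[R]_d0) (W : param_idx d0 net -> R) : R :=
  upper_eval (W \o inr)
    (lifting rho0 (\matrix_(i, j) W (inl (i, j))) x
       : rep_space (regular_rep R gT d1)).

(* The vector representing f_steer(. ; W), see f_steerE. *)
Definition P_steer (R : realType) (gT : finGroupType) (d0 d1 k : nat)
    (rho0 : mx_representation R [set: gT]%SET d0)
    (net : upper_layers k (regular_rep R gT d1))
    (W : param_idx d0 net -> R) : 'cV[R]_d0 :=
  \col_i f_steer rho0 (delta_mx i 0) W.

Definition loss_exp (R : realType) (yhat y : R) : R := expR (- (yhat * y)).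

Definition loss_steer (R : realType) (gT : finGroupType) (d0 d1 k n : nat)
    (rho0 : mx_representation R [set: gT]%SET d0)
    (net : upper_layers k (regular_rep R gT d1))
    (x : 'I_n -> 'cV[R]_d0) (y : 'I_n -> R) (W : param_idx d0 net -> R) : R :=
  \sum_(i < n) loss_exp (dotv (x i) (P_steer rho0 W)) (y i).

Definition partial_deriv (R : realType) (I : finType) (F : (I -> R) -> R)
    (c : I) (W : I -> R) : R :=
  derive1 (fun h : R => F (fun c' => W c' + h * (c' == c)%:R)) 0.

(* Solution of W' = - grad F (W) on [0, +oo[: a one-sided derivative at 0 is
   replaced by right continuity at 0, which is equivalent for smooth F. *)
Definition gradient_flow (R : realType) (I : finType) (F : (I -> R) -> R)
    (W : R -> I -> R) : Prop :=
  (forall c, {within `[0, +oo[, continuous (fun t => W t c)}) /\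
  (forall c (t : R), 0 < t ->
     is_derive t 1 (fun s => W s c) (- partial_deriv F c (W t))).

Lemma upper_eval_linear (R : realType) (gT : finGroupType) (k : nat)
    (X : lin_rep R gT) (net : upper_layers k X) (w : weight_idx net -> R) :
  forall (a : R) (u v : rep_space X),
  upper_eval w (a *: u + v) = a * upper_eval w u + upper_eval w v.
Proof.
elim: net w => [{}X N psi|{}k {}X Y N psi net IH] w a u v /=.
  rewrite mulr_sumr -big_split /=; apply: eq_bigr => j _.
  by rewrite linearP /= mulrDr mulrCA.
rewrite -IH; congr upper_eval.
rewrite scaler_sumr -big_split /=; apply: eq_bigr => j _.
by rewrite linearP /= scalerDr !scalerA mulrC.
Qed.

Lemma f_steer_linear (R : realType) (gT : finGroupType) (d0 d1 k : nat)
    (rho0 : mx_representation R [set: gT]%SET d0)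
    (net : upper_layers k (regular_rep R gT d1)) (W : param_idx d0 net -> R)
    (a : R) (u v : 'cV[R]_d0) :
  f_steer rho0 (a *: u + v) W = a * f_steer rho0 u W + f_steer rho0 v W.
Proof.
rewrite /f_steer -upper_eval_linear; congr upper_eval.
by apply/ffunP => g; rewrite !ffunE !mulmxDr -!scalemxAr.
Qed.

Lemma f_steerE (R : realType) (gT : finGroupType) (d0 d1 k : nat)
    (rho0 : mx_representation R [set: gT]%SET d0)
    (net : upper_layers k (regular_rep R gT d1)) (W : param_idx d0 net -> R)
    (x : 'cV[R]_d0) :
  f_steer rho0 x W = dotv x (P_steer rho0 W).
Proof.
have f0 : f_steer rho0 0 W = 0.
  have := f_steer_linear rho0 W (-1) 0 0.
  by rewrite scaler0 addr0 mulN1r addNr.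
have -> : x = \sum_i x i 0 *: delta_mx i 0 :> 'cV[R]_d0.
  rewrite [LHS]matrix_sum_delta; apply: eq_bigr => i _.
  by rewrite big_ord1.
rewrite (_ : dotv _ _ = \sum_i x i 0 * f_steer rho0 (delta_mx i 0) W); last first.
  apply: eq_bigr => i _; rewrite mxE; congr (_ * _).
  rewrite summxE (bigD1 i) //= big1 ?addr0 => [|j ji]; rewrite !mxE.
    by rewrite !eqxx mulr1.
  by rewrite eq_sym (negbTE ji) mulr0.
elim/big_rec2: _ => // i s z _ <-.
by rewrite f_steer_linear.
Qed.

Lemma orth_proj_range_unique (R : realType) (d : nat) (A : 'M[R]_d)
    (u p : 'cV[R]_d) :
  (exists w, p = A *m w) /\ (forall w, dotv (u - p) (A *m w) = 0) <->
  p = orth_proj_range A u.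
Proof.
have dotE (v w : 'cV[R]_d) : dotv v w = (v^T *m w) 0 0.
  by rewrite mxE; apply: eq_bigr => i _; rewrite mxE.
have dot0 (v : 'cV[R]_d) : dotv v v = 0 -> v = 0.
  move=> /eqP; rewrite psumr_eq0 => [/allP v0|i _]; last exact: sqr_ge0.
  apply/colP => i; rewrite mxE; apply/eqP.
  have := v0 i (mem_index_enum _).
  by rewrite mulf_eq0 orbb.
have cap0 : (A^T :&: kermx A = 0)%MS.
  apply/eqP/rowV0P => v; rewrite sub_capmx => /andP[/submxP[w ->] /sub_kermxP vA].
  apply: trmx_inj; rewrite trmx0; apply: dot0.
  by rewrite dotE trmxK trmx_mul trmxK mulmxA vA mul0mx mxE.
have full : (u^T <= A^T + kermx A)%MS.
  apply: submx_full; rewrite -col_leq_rank.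
  by rewrite mxrank_disjoint_sum // mxrank_tr mxrank_ker subnKC // rank_leq_row.
split=> [[[w pE] porth]|->].
  have pA : (p^T <= A^T)%MS by rewrite pE trmx_mul submxMl.
  have uA : ((u - p)^T <= kermx A)%MS.
    apply/sub_kermxP/rowP => j; rewrite [RHS]mxE.
    have := porth (delta_mx j 0); rewrite dotE mulmxA => <-.
    by rewrite -colE [RHS]mxE.
  apply: trmx_inj; rewrite /orth_proj_range trmxK.
  rewrite -[u in RHS](subrK p) linearD /= mulmxDl.
  by rewrite proj_mx_0 // proj_mx_id // add0r.
split.
  have /submxP[w wE] := proj_mx_sub A^T (kermx A) u^T.
  exists w^T; apply: trmx_inj.
  by rewrite /orth_proj_range trmxK wE trmx_mul trmxK.
move=> w; have /sub_kermxP H := proj_mx_compl_sub full.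
by rewrite dotE linearB /= /orth_proj_range trmxK mulmxA H mul0mx mxE.
Qed.

(* Main.v *)
(* By invariance of the upper layers, the predictor is beta = A^T v with
   v = M u, where A is the group average, M = w_1 and u is a vector-valued
   homogeneous polynomial in the upper weights; the loss only sees the vectors
   z_i = y_i A x_i through the margins q_i = <z_i, v>.

   Homogeneity makes K / rho^L nondecreasing, with K = -ln(loss) and rho the norm
   of all parameters; hence K -> oo, rho -> oo and K >= c rho^L.

   Let b be the least-norm point of the convex hull of the z_i, so that
   gamma^* = b / |b|^2. The rows of M move along S u^T with
   S = sum_i exp(-q_i) z_i, and duality gives <b, S> >= |b|^2 loss and
   <b, v> >= K, whereas <S, v> = sum_i exp(-q_i) q_i <= loss (K + n). Hence the
   squared norm D of the part of M orthogonal to b satisfies D' <= 2 n loss, which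
   is negligible compared with (rho^2)' >= 2 L loss K. So D = o(rho^2), and since
   <b, v> >= K >= c rho^L while |u| = O(rho^(L-1)), v / <b, v> tends to b / |b|^2.
   No limit of W / |W| itself is needed.

   Finally b lies in Range(A), so gamma^* is the orthogonal projection of
   A^T gamma^* onto Range(A), which turns problem (b) into the SVM problem. *)

Require Import Defs.
From HB Require Import structures.
From mathcomp Require Import all_boot all_order all_algebra all_fingroup.
From mathcomp Require Import mxrepresentation.
From mathcomp Require Import all_classical all_reals all_analysis.
From mathcomp Require Import ring lra.
Import Order.TTheory GRing.Theory Num.Theory.
Import numFieldNormedType.Exports.

Set Implicit Arguments.
Unset Strict Implicit.
Unset Printing Implicit Defensive.

Local Open Scope classical_set_scope.
Local Open Scope ring_scope.

(** * Differentiation along curves *)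

Lemma is_derive_bigsum {R : realType} {J : Type} (r : seq J) (P : pred J)
    (F : J -> R -> R) (dF : J -> R) (t : R) :
  (forall i, is_derive t 1 (F i) (dF i)) ->
  is_derive t 1 (fun s => \sum_(i <- r | P i) F i s) (\sum_(i <- r | P i) dF i).
Proof.
move=> dFP; elim: r => [|j r IH].
  have -> : (fun s => \sum_(i <- [::] | P i) F i s) = cst 0.
    by apply/funext => s; rewrite big_nil.
  by rewrite big_nil; apply: is_derive_cst.
rewrite big_cons; have [Pj|Pj] := boolP (P j).
  have -> : (fun s => \sum_(i <- j :: r | P i) F i s) =
            F j + (fun s => \sum_(i <- r | P i) F i s).
    by apply/funext => s; rewrite big_cons Pj.
  exact: is_deriveD.
have -> // : (fun s => \sum_(i <- j :: r | P i) F i s) =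
           (fun s => \sum_(i <- r | P i) F i s).
by apply/funext => s; rewrite big_cons (negbTE Pj).
Qed.

Lemma is_derive_mul {R : realType} (f g : R -> R) (t df dg : R) :
  is_derive t 1 f df -> is_derive t 1 g dg ->
  is_derive t 1 (fun s => f s * g s) (df * g t + f t * dg).
Proof.
move=> hf hg; apply: is_derive_eq (is_deriveM hf hg) _.
by rewrite /GRing.scale /= addrC [g t * _]mulrC.
Qed.

Lemma is_derive_mulc {R : realType} (a : R) (f : R -> R) (t df : R) :
  is_derive t 1 f df -> is_derive t 1 (fun s => a * f s) (a * df).
Proof. exact: is_deriveZ. Qed.

Lemma is_derive_sqr {R : realType} (f : R -> R) (t df : R) :
  is_derive t 1 f df -> is_derive t 1 (fun s => f s ^+ 2) (2 * (f t * df)).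
Proof.
move=> hf; have := is_derive_mul hf hf.
have -> : (fun s => f s * f s) = (fun s => f s ^+ 2).
  by apply/funext => s; rewrite expr2.
by move/is_derive_eq; apply; rewrite [df * _]mulrC mulr2n mulrDl mul1r.
Qed.

Lemma le_of_derive_ge0 {R : realType} (f df : R -> R) (t0 : R) :
  (forall t, t0 <= t -> is_derive t 1 f (df t)) ->
  (forall t, t0 <= t -> 0 <= df t) ->
  forall s t, t0 <= s -> s <= t -> f s <= f t.
Proof.
move=> fdf df0 s t t0s st.
have fdf' z : z \in `]s, t[ -> is_derive z 1 f (df z).
  by rewrite in_itv => /andP[sz _]; apply: fdf; rewrite (le_trans t0s) // ltW.
have [|z /andP[sz _]] := MVT_segment st fdf'.
  apply: continuous_in_subspaceT => z /set_mem.
  rewrite /= in_itv /= => /andP[sz _].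
  apply/differentiable_continuous/derivable1_diffP.
  by have [] := fdf z (le_trans t0s sz).
move=> fE; rewrite -subr_ge0 fE mulr_ge0 ?subr_ge0 // df0 //.
by rewrite (le_trans t0s).
Qed.

(* Differentiability is encoded as the chain rule along curves, which spares any
   topology on I -> R. *)
Definition has_grad {R : realType} {I : finType} (F : (I -> R) -> R)
    (G : (I -> R) -> I -> R) : Prop :=
  forall (w : R -> I -> R) (t : R) (dw : I -> R),
  (forall c, is_derive t 1 (fun s => w s c) (dw c)) ->
  is_derive t 1 (fun s => F (w s)) (\sum_c G (w t) c * dw c).

Section Gradients.
Context {R : realType} {I : finType}.
Implicit Types (F : (I -> R) -> R) (G : (I -> R) -> I -> R).

Lemma has_grad_eq F F' G : F =1 F' -> has_grad F G -> has_grad F' G.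
Proof. by move=> /funext ->. Qed.

Lemma has_grad_coord (c : I) :
  has_grad (fun w : I -> R => w c) (fun _ c' => (c' == c)%:R).
Proof.
move=> w t dw dwP; rewrite (bigD1 c) //= eqxx mul1r big1 ?addr0 // => c' c'c.
by rewrite (negbTE c'c) mul0r.
Qed.

Lemma has_grad_mul F1 G1 F2 G2 : has_grad F1 G1 -> has_grad F2 G2 ->
  has_grad (fun w => F1 w * F2 w) (fun w c => G1 w c * F2 w + F1 w * G2 w c).
Proof.
move=> h1 h2 w t dw dwP.
apply: is_derive_eq (is_derive_mul (h1 _ _ _ dwP) (h2 _ _ _ dwP)) _.
rewrite mulr_suml mulr_sumr -big_split; apply: eq_bigr => c _ /=.
by rewrite mulrDl mulrAC mulrA.
Qed.

Lemma has_grad_mulc a F G :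
  has_grad F G -> has_grad (fun w => a * F w) (fun w c => a * G w c).
Proof.
move=> h w t dw dwP; apply: is_derive_eq (is_derive_mulc a (h _ _ _ dwP)) _.
by rewrite mulr_sumr; apply: eq_bigr => c _; rewrite mulrA.
Qed.

Lemma has_grad_sum (J : finType) (F : J -> (I -> R) -> R)
    (G : J -> (I -> R) -> I -> R) : (forall j, has_grad (F j) (G j)) ->
  has_grad (fun w => \sum_j F j w) (fun w c => \sum_j G j w c).
Proof.
move=> h w t dw dwP.
apply: is_derive_eq (is_derive_bigsum _ _ (fun j => h j _ _ _ dwP)) _.
by rewrite exchange_big; apply: eq_bigr => c _ /=; rewrite mulr_suml.
Qed.

Lemma has_grad_expR F G : has_grad F G ->
  has_grad (fun w => expR (F w)) (fun w c => expR (F w) * G w c).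
Proof.
move=> h w t dw dwP.
apply: is_derive_eq (is_derive1_comp (is_derive_expR _) (h _ _ _ dwP)) _.
by rewrite mulr_sumr; apply: eq_bigr => c _; rewrite mulrA.
Qed.

(** Apply the chain rule to the coordinate line through [w] in direction [c]. This ties gradients
    along curves to the [partial_deriv] in which the flow is stated. *)
Lemma has_grad_partial F G : has_grad F G ->
  forall w c, partial_deriv F c w = G w c.
Proof.
move=> h w c; rewrite /partial_deriv derive1E.
have dw c' : is_derive (0 : R) 1 (fun s => w c' + s * (c' == c)%:R) (c' == c)%:R.
  have -> : (fun s => w c' + s * (c' == c)%:R) = cst (w c') + (c' == c)%:R \*: id.
    by apply/funext => s; rewrite /= !fctE /= [_ *: _]mulrC.
  by apply: is_derive_eq; rewrite add0r /GRing.scale /= mulr1.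
have [_ ->] := h _ _ _ dw; rewrite (bigD1 c) //= eqxx mulr1 big1 ?addr0.
  by congr (G _ c); apply/funext => c'; rewrite mul0r addr0.
by move=> c' /negbTE ->; rewrite mulr0.
Qed.

(** Euler's identity: differentiate [s |-> F (s w)] at [s = 1], once by the chain rule and once as
    [s ^+ k * F w]. *)
Lemma has_grad_euler F G k : has_grad F G ->
  (forall a w, F (fun c => a * w c) = a ^+ k * F w) ->
  forall w, \sum_c G w c * w c = k%:R * F w.
Proof.
move=> h Fk w.
have dw c : is_derive (1 : R) 1 (fun s => s * w c) (w c).
  have -> : (fun s => s * w c) = w c \*: id.
    by apply/funext => s; rewrite /= [_ *: _]mulrC.
  by apply: is_derive_eq; rewrite /GRing.scale /= mulr1.
have [_ <-] : is_derive (1 : R) 1 (fun s => F (fun c => s * w c)) (k%:R * F w).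
  have -> : (fun s => F (fun c => s * w c)) = F w \*: (id ^+ k).
    apply/funext => s; rewrite Fk /= [_ *: _]mulrC; congr (_ * _).
    by rewrite exprfctE.
  by apply: is_derive_eq; rewrite /GRing.scale /= expr1n !mulr1 mulrC.
have := h _ _ _ dw => -[_ ->]; apply: eq_bigr => c _; congr (G _ c * _).
by apply/funext => c'; rewrite mul1r.
Qed.

End Gradients.

(** * Invariant multilinear functionals *)

Section UpperLayers.
Context {R : realType} {gT : finGroupType}.

Lemma upper_eval_sum k (X : lin_rep R gT) (net : upper_layers k X)
    (w : weight_idx net -> R) (J : finType) (a : J -> R)
    (v : J -> rep_space X) :
  upper_eval w (\sum_j a j *: v j) = \sum_j a j * upper_eval w (v j).
Proof.
have e0 : upper_eval w 0 = 0.
  have := upper_eval_linear w (-1) 0 0.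
  by rewrite scaler0 addr0 mulN1r addNr.
elim/big_rec2: _ => // j s v' _ <-.
exact: upper_eval_linear.
Qed.

Lemma upper_eval_scale k (X : lin_rep R gT) (net : upper_layers k X)
    (a : R) (w : weight_idx net -> R) (v : rep_space X) :
  upper_eval (fun c => a * w c) v = a ^+ k * upper_eval w v.
Proof.
elim: net w v => [{}X N psi|{}k {}X Y N psi net IH] w v /=.
  by rewrite expr1 mulr_sumr; apply: eq_bigr => j _; rewrite mulrA.
rewrite (IH (w \o inr)) !upper_eval_sum exprSr -mulrA; congr (_ * _).
by rewrite mulr_sumr; apply: eq_bigr => j _; rewrite mulrA.
Qed.

(** The constant depends on the input [v], which is fixed. Each layer expands linearly over the
    images [psi j v], so one factor [r] comes out per layer and the constants of the images add
    up. *)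
Lemma upper_eval_bound k (X : lin_rep R gT) (net : upper_layers k X)
    (v : rep_space X) :
  exists2 C : R, 0 <= C & forall (w : weight_idx net -> R) (r : R), 0 <= r ->
    (forall c, `|w c| <= r) -> `|upper_eval w v| <= C * r ^+ k.
Proof.
elim: net v => [{}X N psi|{}k {}X Y N psi net IH] v.
  exists (\sum_(j < N) `|psi j v : R|) => [|w r r0 wr /=].
    by apply: sumr_ge0.
  rewrite expr1 mulr_suml; apply: le_trans (ler_norm_sum _ _ _) _.
  by apply: ler_sum => j _; rewrite normrM mulrC ler_wpM2l.
have /choice[C CP] : forall j, exists C : R, 0 <= C /\
    forall (w : weight_idx net -> R) (r : R), 0 <= r ->
    (forall c, `|w c| <= r) -> `|upper_eval w (psi j v)| <= C * r ^+ k.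
  by move=> j; have [C C0 CP] := IH (psi j v); exists C.
have C0 j : 0 <= C j by have [] := CP j.
exists (\sum_(j < N) C j) => [|w r r0 wr /=]; first exact: sumr_ge0.
rewrite upper_eval_sum mulr_suml; apply: le_trans (ler_norm_sum _ _ _) _.
apply: ler_sum => j _; rewrite normrM exprS mulrCA.
by apply: ler_pM => //; apply: (CP j).2 => // c; apply: wr.
Qed.

Lemma upper_eval_grad k (X : lin_rep R gT) (net : upper_layers k X)
    (v : rep_space X) :
  exists G, has_grad (fun w : weight_idx net -> R => upper_eval w v) G.
Proof.
elim: net v => [{}X N psi|{}k {}X Y N psi net IH] v.
  eexists; apply: has_grad_sum => j /=.
  apply: (@has_grad_eq _ _ (fun w => (psi j v : R) * w j)) => [w|].
    by rewrite mulrC.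
  exact/has_grad_mulc/has_grad_coord.
have [G GP] := choice (fun j => IH (psi j v)).
(* The gradient of the remaining layers, extended by zero to the weights of the current layer. *)
pose G' j (w : 'I_N + weight_idx net -> R) (c : 'I_N + weight_idx net) :=
  if c is inr c' then G j (w \o inr) c' else 0.
have G'P j : has_grad (fun w : 'I_N + weight_idx net -> R =>
    upper_eval (w \o inr : weight_idx net -> R) (psi j v)) (G' j).
  move=> w t dw dwP; rewrite big_sumType /= big1 ?add0r => [|i _]; last first.
    by rewrite mul0r.
  exact: (GP j (fun s => w s \o inr) t (dw \o inr) (fun c => dwP (inr c))).
pose F (w : 'I_N + weight_idx net -> R) := \sum_j w (inl j) *
  upper_eval (w \o inr : weight_idx net -> R) (psi j v).
have FE : F =1 fun w => @upper_eval R gT _ X (HiddenLayer psi net) w v.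
  by move=> w; rewrite /F /= upper_eval_sum.
have FP := has_grad_sum (fun j => has_grad_mul (has_grad_coord (inl j)) (G'P j)).
eexists; exact: has_grad_eq FE FP.
Qed.

(** Equivariance carries [g] up through the layers to the output, where the action is trivial. *)
Lemma upper_eval_invariant k (X : lin_rep R gT) (net : upper_layers k X)
    (w : weight_idx net -> R) (g : gT) (v : rep_space X) :
  upper_eval w (rep_act g v) = upper_eval w v.
Proof.
elim: net w v => [{}X N psi|{}k {}X Y N psi net IH] w v /=.
  by apply: eq_bigr => j _; rewrite intertwinerP.
rewrite -[RHS]IH; congr upper_eval.
have act0 : rep_act g (0 : rep_space Y) = 0.
  have := rep_act_linear g (-1) (0 : rep_space Y) 0.
  by rewrite scaler0 addr0 scaleN1r addNr.
elim/big_rec2: _ => [//|j a b _ ->].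
by rewrite intertwinerP -rep_act_linear.
Qed.

(* Averaging over the group turns a function into a constant one, without
   changing the value of an invariant functional. *)
Lemma upper_eval_regular d1 k (net : upper_layers k (regular_rep R gT d1))
    (w : weight_idx net -> R) (f : {ffun gT -> 'cV[R]_d1}) :
  upper_eval w (f : rep_space (regular_rep R gT d1)) =
  \sum_(j < d1) (#|gT|%:R^-1 *: \sum_g f g) j 0 *
    upper_eval w ([ffun=> delta_mx j 0] : rep_space (regular_rep R gT d1)).
Proof.
have n0 : #|gT|%:R != 0 :> R.
  by rewrite pnatr_eq0 -lt0n; apply/card_gt0P; exists 1%g.
rewrite -upper_eval_sum.
transitivity (upper_eval w
  (\sum_(g : gT) #|gT|%:R^-1 *: (regular_act g f : rep_space (regular_rep R gT d1)))).
  rewrite upper_eval_sum -mulr_sumr (eq_bigr (fun=> upper_eval w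
    (f : rep_space (regular_rep R gT d1)))) => [|g _]; last first.
    exact: (upper_eval_invariant w g).
  by rewrite sumr_const -[X in _ * X]mulr_natl mulrA mulVf ?mul1r.
congr upper_eval; apply/ffunP => h; rewrite !sum_ffunE.
apply/colP => j; rewrite !summxE.
rewrite [RHS](bigD1 j) //= [X in _ + X]big1 ?addr0 => [|i ij]; last first.
  by rewrite !ffunE !mxE eq_sym (negbTE ij) mulr0.
rewrite !ffunE !mxE eqxx mulr1 summxE mulr_sumr.
(* Replacing [g] by [h g^-1] turns [f (g^-1 h)] into [f g], so the sum of the translates does not
   depend on [h]. *)
rewrite (reindex_inj (inj_comp (mulgI h) invg_inj)) /=.
by apply: eq_bigr => g _; rewrite !ffunE !mxE /= invMg invgK mulgKV.
Qed.

End UpperLayers.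

(** * Euclidean geometry and the minimal-norm point *)

Section Euclidean.
Context {R : realType}.

Section Dot.
Context {d : nat}.
Implicit Types u v w : 'cV[R]_d.

Lemma dotvE u v : dotv u v = (u^T *m v) 0 0.
Proof. by rewrite mxE; apply: eq_bigr => i _; rewrite mxE. Qed.

Lemma dotvC u v : dotv u v = dotv v u.
Proof. by apply: eq_bigr => i _; rewrite mulrC. Qed.

Lemma dotvDr u v w : dotv u (v + w) = dotv u v + dotv u w.
Proof. by rewrite !dotvE mulmxDr mxE. Qed.

Lemma dotvBr u v w : dotv u (v - w) = dotv u v - dotv u w.
Proof. by rewrite !dotvE mulmxBr !mxE. Qed.

Lemma dotvZr a u v : dotv u (a *: v) = a * dotv u v.
Proof. by rewrite !dotvE -scalemxAr mxE. Qed.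

Lemma dotvZl a u v : dotv (a *: u) v = a * dotv u v.
Proof. by rewrite dotvC dotvZr dotvC. Qed.

Lemma dotvBl u v w : dotv (u - v) w = dotv u w - dotv v w.
Proof. by rewrite dotvC dotvBr !(dotvC w). Qed.

Lemma dotv_sumr (J : finType) (v : J -> 'cV[R]_d) u :
  dotv u (\sum_j v j) = \sum_j dotv u (v j).
Proof. by rewrite dotvE mulmx_sumr summxE; apply: eq_bigr => j _; rewrite dotvE. Qed.

Lemma dotv_ge0 u : 0 <= dotv u u.
Proof. by apply: sumr_ge0 => i _; apply: sqr_ge0. Qed.

Lemma dotv0 u : dotv u 0 = 0.
Proof. by rewrite dotvE mulmx0 mxE. Qed.

Lemma dotv_eq0 u : dotv u u = 0 -> u = 0.
Proof.
move/eqP; rewrite psumr_eq0 => [/allP u0|i _]; last exact: sqr_ge0.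
apply/colP => i; rewrite mxE; apply/eqP.
by have := u0 i (mem_index_enum _); rewrite mulf_eq0 orbb.
Qed.

Lemma dotv_gt0 u : u != 0 -> 0 < dotv u u.
Proof.
move=> u0; rewrite lt_def dotv_ge0 andbT.
by apply: contraNneq u0 => /dotv_eq0 ->.
Qed.

Lemma norm2_sqr u : norm2 u ^+ 2 = dotv u u.
Proof. by rewrite sqr_sqrtr // dotv_ge0. Qed.

Lemma norm2_gt0 u : u != 0 -> 0 < norm2 u.
Proof. by move=> u0; rewrite sqrtr_gt0 dotv_gt0. Qed.

Lemma norm2Z a u : 0 <= a -> norm2 (a *: u) = a * norm2 u.
Proof.
move=> a0; rewrite /norm2 dotvZl dotvZr mulrA -expr2 sqrtrM ?sqr_ge0 //.
by rewrite sqrtr_sqr ger0_norm.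
Qed.

Lemma normalize_scale a u : 0 < a ->
  (norm2 (a *: u))^-1 *: (a *: u) = (norm2 u)^-1 *: u.
Proof.
move=> a0; rewrite norm2Z 1?ltW // scalerA invfM mulrAC mulVf ?mul1r //.
by rewrite gt_eqF.
Qed.

End Dot.

Lemma dotv_mulmx d m (A : 'M[R]_(d, m)) (u : 'cV[R]_m) (v : 'cV[R]_d) :
  dotv (A *m u) v = dotv u (A^T *m v).
Proof. by rewrite !dotvE trmx_mul mulmxA. Qed.

(** Cauchy-Schwarz, read off from [\sum_j (A b_j - S a_j)^2 = A (A B - S^2)]; the degenerate case
    [A = 0] is treated apart. *)
Lemma sum_sqr_le (J : finType) (a b : J -> R) :
  (\sum_j a j * b j) ^+ 2 <= (\sum_j a j ^+ 2) * (\sum_j b j ^+ 2).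
Proof.
set S := \sum_j _; set A := \sum_j a j ^+ 2; set B := \sum_j b j ^+ 2.
have A0 : 0 <= A by apply: sumr_ge0 => j _; apply: sqr_ge0.
have [A00|An0] := eqVneq A 0.
  have a0 j : a j = 0.
    move/eqP: A00; rewrite psumr_eq0 => [/allP a0|i _]; last exact: sqr_ge0.
    by have := a0 j (mem_index_enum _); rewrite sqrf_eq0 => /eqP.
  by rewrite A00 /S big1 ?expr0n ?mul0r // => j _; rewrite a0 mul0r.
have : 0 <= \sum_j (A * b j - S * a j) ^+ 2.
  by apply: sumr_ge0 => j _; apply: sqr_ge0.
have -> : \sum_j (A * b j - S * a j) ^+ 2 = A * (A * B - S ^+ 2).
  transitivity (\sum_j (A ^+ 2 * b j ^+ 2 - 2 * A * S * (a j * b j) +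
    S ^+ 2 * a j ^+ 2)); first by apply: eq_bigr => j _; ring.
  rewrite big_split sumrB -!mulr_sumr /= -/A -/B -/S.
  by ring.
by rewrite pmulr_rge0 ?subr_ge0 // lt_def An0.
Qed.

Lemma cvg_col (T : Type) (F : set_system T) {FF : Filter F} d
    (f : T -> 'cV[R]_d) (l : 'cV[R]_d) :
  (forall i, f t i 0 @[t --> F] --> l i 0) -> f t @[t --> F] --> l.
Proof.
move=> fl; apply/cvgrPdist_le => e e0.
have : \forall t \near F, forall i, `|l i 0 - f t i 0| <= e.
  by apply: filter_forall => i; have /cvgrPdist_le := fl i; apply.
apply: filterS => t te; rewrite [leLHS]/Num.Def.normr /= mx_normrE.
apply: bigmax_le; first exact: ltW.
by move=> [i j] _ /=; rewrite ord1 !mxE.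
Qed.

Lemma cvg_sumr (T : Type) (F : set_system T) {FF : Filter F} (J : Type)
    (s : seq J) (f : J -> T -> R) (l : J -> R) :
  (forall i, f i t @[t --> F] --> l i) ->
  \sum_(i <- s) f i t @[t --> F] --> \sum_(i <- s) l i.
Proof.
move=> fl; elim: s => [|i s IH].
  by under eq_fun do rewrite big_nil; rewrite big_nil; apply: cvg_cst.
under eq_fun do rewrite big_cons.
by rewrite big_cons; apply: cvgD.
Qed.

Lemma cvg_coord (T : Type) (F : set_system T) {FF : Filter F} m d
    (f : T -> 'M[R]_(m, d)) (l : 'M[R]_(m, d)) i j :
  f t @[t --> F] --> l -> f t i j @[t --> F] --> l i j.
Proof. by move=> fl; exact: (cvg_comp _ _ fl (@coord_continuous R m d i j l)). Qed.

Lemma cvg_dotv (T : Type) (F : set_system T) {FF : Filter F} d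
    (f g : T -> 'cV[R]_d) (l k : 'cV[R]_d) :
  f t @[t --> F] --> l -> g t @[t --> F] --> k ->
  dotv (f t) (g t) @[t --> F] --> dotv l k.
Proof. by move=> fl gk; apply: cvg_sumr => i; apply: cvgM; apply: cvg_coord. Qed.

Lemma cvg_mulmx (T : Type) (F : set_system T) {FF : Filter F} m d
    (A : 'M[R]_(m, d)) (f : T -> 'cV[R]_d) (l : 'cV[R]_d) :
  f t @[t --> F] --> l -> A *m f t @[t --> F] --> A *m l.
Proof.
move=> fl; apply: cvg_col => i; rewrite mxE.
under eq_fun do rewrite mxE.
by apply: cvg_sumr => j; apply: cvgM; [exact: cvg_cst | exact: cvg_coord].
Qed.

Lemma cvg_normalize (T : Type) (F : set_system T) {FF : Filter F} d
    (f : T -> 'cV[R]_d) (l : 'cV[R]_d) : l != 0 ->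
  f t @[t --> F] --> l ->
  (norm2 (f t))^-1 *: f t @[t --> F] --> (norm2 l)^-1 *: l.
Proof.
move=> l0 fl; apply: cvgZ => //; apply: cvgV; first by rewrite gt_eqF ?norm2_gt0.
exact: (cvg_comp _ _ (cvg_dotv fl fl) (@sqrt_continuous R _)).
Qed.

End Euclidean.

Section MinNormPoint.
Context {R : realType} {d n : nat}.
Variable z : 'I_n -> 'cV[R]_d.

(* The least-norm point of the convex hull of the z k: its normalization is
   the direction of the maximal margin (hard-margin SVM duality). *)
Lemma min_norm_point : (0 < n)%N ->
  exists p : 'I_n -> R, let b := \sum_k p k *: z k in
  [/\ forall k, 0 <= p k, \sum_k p k = 1 & forall k, dotv b b <= dotv b (z k)].
Proof.
move=> n0.
(* The minimum is taken over the weights: they range over a simplex, a closed subset of the compact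
   unit box. *)
pose comb (p : 'rV[R]_n) := \sum_k p 0 k *: z k.
pose f (p : 'rV[R]_n) := - dotv (comb p) (comb p).
pose box := [set p : 'rV[R]_n | forall k, p ord0 k \in `[(0 : R), 1]].
pose A := box `&` [set p | \sum_k p 0 k = 1].
have boxc : compact box.
  by apply: (@rV_compact _ _ (fun=> `[(0 : R), 1]%classic)) => i; apply: segment_compact.
have Ac : compact A.
  apply: compact_closedI => //.
  apply: (@preimage_closed _ _ (fun p : 'rV[R]_n => \sum_k p 0 k) [set x | x = 1]).
    by move=> p _; apply: (@cvg_sumr _ _ _ (nbhs_filter p)) => k; apply: coord_continuous.
  exact: closed_eq.
have A0 : A !=set0.
  exists (delta_mx 0 (Ordinal n0)); split => [k|] /=.
    by rewrite mxE eqxx /= in_itv /=; case: (_ == _); rewrite ?ler01 !lexx.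
  rewrite (bigD1 (Ordinal n0)) //= mxE !eqxx big1 ?addr0 // => k kn0.
  by rewrite mxE (negbTE kn0) andbF.
have fc : {within A, continuous f}.
  apply: continuous_subspaceT => p.
  have combc : comb q @[q --> p] --> comb p.
    apply: (@cvg_col _ _ _ (nbhs_filter p)) => i; rewrite summxE; under eq_fun do rewrite summxE.
    apply: (@cvg_sumr _ _ _ (nbhs_filter p)) => k; rewrite mxE; under eq_fun do rewrite mxE.
    by apply: cvgM; [exact: coord_continuous | exact: cvg_cst].
  exact: (@cvgN _ _ _ (nbhs p) (nbhs_filter p) _ _
    (@cvg_dotv _ _ _ (nbhs_filter p) _ _ _ _ _ combc combc)).
have [p /set_mem[pbox /= p1] pmin] := compact_EVT_max A0 Ac fc.
have p0 k : 0 <= p 0 k by have := pbox k; rewrite in_itv => /andP[].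
exists (p 0); split => // k; set b := \sum_k _.
have bE : b = comb p by [].
(* first-order optimality along the segment from p to the vertex k *)
have step (s : R) : 0 <= s -> s <= 1 ->
    0 <= s * (2 * (dotv b (z k) - dotv b b)) + s ^+ 2 * dotv (z k - b) (z k - b).
  move=> s0 s1; pose q := (1 - s) *: p + s *: delta_mx 0 k.
  have q1 : \sum_i q 0 i = 1.
    rewrite (eq_bigr (fun i => (1 - s) * p 0 i + s * (i == k)%:R)) => [|i _].
      rewrite big_split -!mulr_sumr p1 (bigD1 k) //= eqxx big1 ?addr0.
        by rewrite !mulr1 subrK.
      by move=> i /negbTE ->.
    by rewrite !mxE eqxx.
  have q0 i : 0 <= q 0 i.
    by rewrite !mxE addr_ge0 // mulr_ge0 // subr_ge0.
  have qA : q \in A.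
    apply/mem_set; split => // i; rewrite in_itv /= q0 /= -q1.
    by rewrite (bigD1 i) //= lerDl sumr_ge0.
  have combq : comb q = b + s *: (z k - b).
    rewrite /comb (eq_bigr (fun i => (1 - s) *: (p 0 i *: z i) +
      s *: ((i == k)%:R *: z i))) => [|i _].
      rewrite big_split -!scaler_sumr /=.
      rewrite [\sum_i (i == k)%:R *: z i](bigD1 k) //= eqxx scale1r.
      rewrite [\sum_(i | i != k) _]big1 ?addr0 => [|i /negbTE ->]; last by rewrite scale0r.
      by rewrite -/b scalerBl scale1r scalerBr -addrA [- _ + _]addrC.
    by rewrite !scalerA -scalerDl !mxE eqxx.
  rewrite !(dotvBr, dotvBl) (dotvC (z k) b).
  have := pmin _ qA; rewrite /f lerN2 -bE combq -subr_ge0.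
  rewrite !(dotvDr, dotvC (_ + _)) !dotvZr !(dotvC (_ *: _)) !dotvZr.
  rewrite !(dotvBr, dotvBl) (dotvC (z k) b).
  by congr (0 <= _); ring.
rewrite leNgt; apply/negP => lt.
set e := dotv b b - dotv b (z k) in lt *.
have e0 : 0 < e by rewrite subr_gt0.
set m := dotv (z k - b) (z k - b) in step.
have m0 : 0 <= m := dotv_ge0 _.
have em : 0 < e + m by lra.
(* The step [s = e / (e + m)] satisfies [s m = e - s e], so [-2 e + s m < 0] contradicts optimality.
   It lies in []0, 1]] even when [m = 0]. *)
have s1 : e / (e + m) <= 1 by rewrite ler_pdivrMr // mul1r lerDl.
have s0 : 0 < e / (e + m) by rewrite divr_gt0.
have := step _ (ltW s0) s1.
have -> : dotv b (z k) - dotv b b = - e by rewrite opprB.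
set s := e / (e + m) in s0 s1 *.
have sE : s * (e + m) = e by rewrite mulfVK ?gt_eqF.
rewrite expr2 -mulrA -mulrDr pmulr_rge0 //.
nra.
Qed.

End MinNormPoint.

(** * Gradient flow of the exponential loss of a homogeneous model *)

Section ExpLoss.
Context {R : realType} {I : finType} {n : nat}.
Implicit Types (q : 'I_n -> (I -> R) -> R) (w : I -> R).

Definition exp_loss q w : R := \sum_k expR (- q k w).

(** The log-sum-exp smoothing of the minimum of the [q k]. *)
Definition soft_margin q w : R := - ln (exp_loss q w).

Definition weighted_margin q w : R := \sum_k expR (- q k w) * q k w.

Definition sqnorm w : R := \sum_c w c ^+ 2.

Lemma sqnorm_ge0 w : 0 <= sqnorm w.
Proof. by apply: sumr_ge0 => c _; apply: sqr_ge0. Qed.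

Lemma le_sqrt_sqnorm w c : `|w c| <= Num.sqrt (sqnorm w).
Proof.
rewrite -sqrtr_sqr ler_wsqrtr // /sqnorm (bigD1 c) //= lerDl.
by apply: sumr_ge0 => c' _; apply: sqr_ge0.
Qed.

Lemma expR_le_exp_loss q w k : expR (- q k w) <= exp_loss q w.
Proof.
rewrite /exp_loss (bigD1 k) //= lerDl.
by apply: sumr_ge0 => k' _; apply: expR_ge0.
Qed.

Lemma exp_loss_gt0 q w : (0 < n)%N -> 0 < exp_loss q w.
Proof.
by move=> n0; apply: lt_le_trans (expR_le_exp_loss q w (Ordinal n0)); apply: expR_gt0.
Qed.

Lemma expR_soft_margin q w : (0 < n)%N -> expR (- soft_margin q w) = exp_loss q w.
Proof. by move=> n0; rewrite opprK lnK // posrE exp_loss_gt0. Qed.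

Lemma soft_margin_le q w k : soft_margin q w <= q k w.
Proof.
have n0 : (0 < n)%N by apply: leq_ltn_trans (ltn_ord k).
by rewrite -lerN2 -ler_expR expR_soft_margin // expR_le_exp_loss.
Qed.

Lemma weighted_margin_ge q w :
  exp_loss q w * soft_margin q w <= weighted_margin q w.
Proof.
rewrite mulr_suml; apply: ler_sum => k _.
by rewrite ler_pM2l ?expR_gt0 ?soft_margin_le.
Qed.

(** With [x] the excess of [q k] over the soft margin, the [k]-th term contributes
    [exp_loss * x exp(-x)] beyond its share of the product, and [x exp(-x) <= 1] because
    [1 + x <= exp x]. *)
Lemma weighted_margin_le q w :
  weighted_margin q w <= exp_loss q w * soft_margin q w + n%:R * exp_loss q w.
Proof.
rewrite mulr_suml -lerBlDl -sumrB.
have -> : n%:R * exp_loss q w = \sum_(k < n) exp_loss q w.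
  by rewrite sumr_const card_ord mulr_natl.
apply: ler_sum => k _; rewrite -mulrBr.
have n0 : (0 < n)%N by apply: leq_ltn_trans (ltn_ord k).
set x := q k w - soft_margin q w.
have -> : expR (- q k w) = exp_loss q w * expR (- x).
  by rewrite -expR_soft_margin // -expRD; congr expR; rewrite /x; ring.
rewrite -mulrA ler_piMr ?(ltW (exp_loss_gt0 q w n0)) //.
rewrite expRN mulrC ler_pdivrMr ?expR_gt0 // mul1r.
by apply: le_trans (expR_ge1Dx x); rewrite lerDr.
Qed.

End ExpLoss.

(** * Growth of the margin and of the parameters along the flow *)

Section HomogeneousFlow.
Context {R : realType} {I : finType} {n L : nat}.
Variables (q : 'I_n -> (I -> R) -> R) (G : 'I_n -> (I -> R) -> I -> R).
Variables (W : R -> I -> R) (t0 : R).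
Hypotheses (n_gt0 : (0 < n)%N) (L_gt1 : (1 < L)%N).
Hypothesis q_grad : forall k, has_grad (q k) (G k).
Hypothesis q_homog : forall k a w, q k (fun c => a * w c) = a ^+ L * q k w.
Hypothesis q_bound : exists2 C : R, 0 <= C & forall k w (r : R), 0 <= r ->
  (forall c, `|w c| <= r) -> `|q k w| <= C * r ^+ L.
Hypothesis t0_gt0 : 0 < t0.
Hypothesis flow : forall c (t : R), 0 < t ->
  is_derive t 1 (fun s => W s c) (- partial_deriv (exp_loss q) c (W t)).
Hypothesis loss_lt1 : exp_loss q (W t0) < 1.

Let l t := exp_loss q (W t).
Let K t := soft_margin q (W t).
Let nu t := weighted_margin q (W t).
Let r t := sqnorm (W t).
(** The velocity of the flow, that is, minus the gradient of the loss; [g2] below is the squared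
    speed. *)
Let dl c t := \sum_k expR (- q k (W t)) * G k (W t) c.
Implicit Types (s t : R) (c : I).
Let g2 t := \sum_c dl c t ^+ 2.

Lemma exp_loss_grad :
  has_grad (exp_loss q) (fun w c => - \sum_k expR (- q k w) * G k w c).
Proof.
have h k : has_grad (fun w => expR (- q k w)) (fun w c => - (expR (- q k w) * G k w c)).
  have := has_grad_expR (has_grad_mulc (-1) (@q_grad k)).
  move=> h w t dw dwP; move: (h w t dw dwP); rewrite mulN1r.
  under eq_fun do rewrite mulN1r; move/is_derive_eq; apply.
  by apply: eq_bigr => c _; rewrite mulN1r mulrN.
move=> w t dw dwP; apply: is_derive_eq (has_grad_sum h dwP) _.
by apply: eq_bigr => c _; rewrite sumrN.
Qed.

Lemma flow_velocity c t : 0 < t -> is_derive t 1 (fun s => W s c) (dl c t).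
Proof.
move=> tp; apply: is_derive_eq (flow c tp) _.
by rewrite (has_grad_partial exp_loss_grad) opprK.
Qed.

Let pos t : t0 <= t -> 0 < t.
Proof. exact: lt_le_trans. Qed.

Lemma loss_derive t : 0 < t -> is_derive t 1 l (- g2 t).
Proof.
move=> tp; apply: is_derive_eq (exp_loss_grad (fun c => flow_velocity c tp)) _.
by rewrite -sumrN; apply: eq_bigr => c _; rewrite mulNr expr2.
Qed.

(** Euler's identity for each [q k], weighted by [expR (- q k)]. *)
Lemma velocity_radial t : \sum_c dl c t * W t c = L%:R * nu t.
Proof.
rewrite mulr_sumr (eq_bigr (fun c => \sum_k expR (- q k (W t)) *
  (G k (W t) c * W t c))) => [|c _]; last first.
  by rewrite mulr_suml; apply: eq_bigr => k _; rewrite mulrA.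
rewrite exchange_big; apply: eq_bigr => k _ /=.
by rewrite -mulr_sumr (has_grad_euler (@q_grad k) (q_homog k)) mulrCA.
Qed.

Lemma sqnorm_derive t : 0 < t -> is_derive t 1 r (2 * (L%:R * nu t)).
Proof.
move=> tp.
apply: is_derive_eq (is_derive_bigsum _ _ (fun c => is_derive_sqr (flow_velocity c tp))) _.
rewrite -mulr_sumr -velocity_radial; congr (_ * _).
by apply: eq_bigr => c _; rewrite mulrC.
Qed.

Lemma radial_le_speed t : (L%:R * nu t) ^+ 2 <= r t * g2 t.
Proof. by rewrite -velocity_radial mulrC sum_sqr_le. Qed.

Lemma loss_nonincr s t : t0 <= s -> s <= t -> l t <= l s.
Proof.
move=> t0s st; rewrite -lerN2.
apply: (@le_of_derive_ge0 _ (fun x => - l x) g2 t0) => // x t0x; last first.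
  by apply: sumr_ge0 => c _; apply: sqr_ge0.
by apply: is_derive_eq (is_deriveN (loss_derive (pos t0x))) _; rewrite opprK.
Qed.

Lemma soft_margin_gt0 t : t0 <= t -> 0 < K t.
Proof.
move=> t0t; rewrite oppr_gt0 ln_lt0 // exp_loss_gt0 //=.
exact: le_lt_trans (loss_nonincr (lexx _) t0t) loss_lt1.
Qed.

Lemma soft_margin_derive t : 0 < t -> is_derive t 1 K (g2 t / l t).
Proof.
move=> tp; have lp : 0 < l t by apply: exp_loss_gt0.
apply: is_derive_eq (is_deriveN (is_derive1_comp (is_derive1_ln lp) (loss_derive tp))) _.
by rewrite mulrN opprK mulrC.
Qed.

Lemma weighted_margin_gt0 t : t0 <= t -> 0 < nu t.
Proof.
move=> t0t; apply: lt_le_trans (weighted_margin_ge _ _).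
by rewrite mulr_gt0 ?soft_margin_gt0 ?exp_loss_gt0.
Qed.

Lemma sqnorm_nondecr s t : t0 <= s -> s <= t -> r s <= r t.
Proof.
apply: (@le_of_derive_ge0 _ r (fun t => 2 * (L%:R * nu t))) => x t0x.
  exact: sqnorm_derive (pos t0x).
by rewrite !mulr_ge0 // ltW // weighted_margin_gt0.
Qed.

(** At the origin every [q k] vanishes by homogeneity, which contradicts the positive soft
    margin. *)
Lemma sqnorm_gt0 t : t0 <= t -> 0 < r t.
Proof.
move=> t0t; rewrite lt_def sqnorm_ge0 andbT; apply/negP => /eqP r0.
have W0 c : W t c = 0.
  apply/eqP; rewrite -normr_le0; apply: le_trans (le_sqrt_sqnorm _ _) _.
  by rewrite [sqnorm _]r0 sqrtr0.
have := lt_le_trans (soft_margin_gt0 t0t) (soft_margin_le q (W t) (Ordinal n_gt0)).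
have -> : W t = fun c => 0 * W t c by apply/funext => c; rewrite mul0r W0.
by rewrite q_homog expr0n gtn_eqF ?mul0r ?ltxx // (ltn_trans _ L_gt1).
Qed.

(* The normalized margin is nondecreasing: its logarithmic derivative is
   nonnegative by Euler's identity and the Cauchy-Schwarz inequality. *)
Lemma soft_margin_growth : exists2 a : R, 0 < a &
  forall t, t0 <= t -> a * Num.sqrt (r t) ^+ L <= K t.
Proof.
(* Since [r] is the squared norm, [phi] is twice the logarithm of [K / sqrt r ^+ L]. The constant
   [expR (phi t0 / 2)] chosen below is thus the normalized margin at [t0]. *)
pose phi t := 2 * ln (K t) - L%:R * ln (r t).
have dphi t : t0 <= t -> is_derive t 1 phi
    (2 * (g2 t / l t / K t) - L%:R * (2 * (L%:R * nu t) / r t)).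
  move=> t0t; have tp := pos t0t.
  have h1 := is_derive1_comp (is_derive1_ln (soft_margin_gt0 t0t)) (soft_margin_derive tp).
  have h2 := is_derive1_comp (is_derive1_ln (sqnorm_gt0 t0t)) (sqnorm_derive tp).
  apply: is_derive_eq (is_deriveB (is_derive_mulc 2 h1) (is_derive_mulc L%:R h2)) _.
  by rewrite ![_^-1 * _]mulrC.
have phi_ge t : t0 <= t -> phi t0 <= phi t.
  apply: (le_of_derive_ge0 dphi) => // x t0x; rewrite subr_ge0.
  have rp := sqnorm_gt0 t0x; have Kp := soft_margin_gt0 t0x.
  have lp : 0 < l x by apply: exp_loss_gt0.
  have np := weighted_margin_gt0 t0x.
  have h1 := radial_le_speed x.
  have h2 : l x * K x <= nu x := weighted_margin_ge _ _.
  rewrite -subr_ge0.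
  have -> : 2 * (g2 x / l x / K x) - L%:R * (2 * (L%:R * nu x) / r x) =
      2 * (r x * g2 x - L%:R ^+ 2 * nu x * (l x * K x)) / (l x * K x * r x).
    by field; rewrite !gt_eqF.
  apply: divr_ge0; last by rewrite !mulr_ge0 // ltW.
  rewrite mulr_ge0 // subr_ge0; apply: le_trans h1.
  have -> : (L%:R * nu x) ^+ 2 = L%:R ^+ 2 * nu x * nu x by ring.
  by rewrite ler_wpM2l // mulr_ge0 ?sqr_ge0 // ltW.
exists (expR (phi t0 / 2)) => [|t t0t]; first exact: expR_gt0.
have rp := sqnorm_gt0 t0t.
have -> : Num.sqrt (r t) = expR (ln (r t) / 2).
  apply: (@pexpIrn _ 2) => //; rewrite ?nnegrE ?sqrtr_ge0 ?expR_ge0 //.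
  rewrite sqr_sqrtr ?sqnorm_ge0 // -expRM_natl.
  by rewrite mulrC divfK ?lnK // pnatr_eq0.
rewrite -expRM_natl -expRD -[leRHS]lnK ?posrE ?soft_margin_gt0 // ler_expR.
have := phi_ge t t0t; rewrite /phi; lra.
Qed.

(** The inverse loss grows at least linearly: its derivative [g2 / l^2] is at least [L^2 nu^2 / (r
    l^2) >= L^2 K^2 / r >= L^2 a^2 r^(L-1)], and [r] does not drop below [r t0]. *)
Lemma soft_margin_unbounded (A : R) : exists2 T, t0 <= T & forall t, T <= t -> A <= K t.
Proof.
have [a a0 aP] := soft_margin_growth.
pose c := L%:R ^+ 2 * (a ^+ 2 * r t0 ^+ L.-1).
have cp : 0 < c.
  by rewrite !mulr_gt0 ?exprn_gt0 ?sqnorm_gt0 // ltr0n (ltn_trans _ L_gt1).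
have dh t : t0 <= t -> is_derive t 1 (fun s => (l s)^-1 - c * s) (g2 t / l t ^+ 2 - c).
  move=> t0t; have tp := pos t0t; have lp : 0 < l t by apply: exp_loss_gt0.
  have l0 : l t != 0 by rewrite gt_eqF.
  apply: is_derive_eq (is_deriveB (is_deriveV l0 (loss_derive tp))
    (is_derive_mulc c (is_derive_id t 1))) _.
  by rewrite mulr1 /GRing.scale /= mulrNN mulrC.
have h t : t0 <= t -> c * (t - t0) <= (l t)^-1.
  move=> t0t; suff : (l t0)^-1 - c * t0 <= (l t)^-1 - c * t.
    have : 0 < (l t0)^-1 by rewrite invr_gt0 exp_loss_gt0.
    lra.
  apply: (le_of_derive_ge0 dh) => // x t0x; rewrite subr_ge0.
  have rp := sqnorm_gt0 t0x; have Kp := soft_margin_gt0 t0x.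
  have lp : 0 < l x by apply: exp_loss_gt0.
  rewrite ler_pdivlMr ?exprn_gt0 //.
  have hK : a ^+ 2 * (r x * r t0 ^+ L.-1) <= K x ^+ 2.
    apply: (@le_trans _ _ ((a * Num.sqrt (r x) ^+ L) ^+ 2)).
      rewrite exprMn exprAC sqr_sqrtr ?sqnorm_ge0 // ler_pM2l ?exprn_gt0 //.
      rewrite -[X in _ <= _ ^+ X](ltn_predK L_gt1) exprS ler_pM2l //.
      by rewrite lerXn2r ?nnegrE ?sqnorm_ge0 ?sqnorm_nondecr.
    have h0 : 0 <= a * Num.sqrt (r x) ^+ L.
      by rewrite mulr_ge0 ?(ltW a0) ?exprn_ge0 ?sqrtr_ge0.
    by rewrite lerXn2r ?nnegrE ?aP ?(ltW Kp).
  rewrite -(ler_pM2l rp); apply: le_trans (radial_le_speed x).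
  rewrite exprMn [leLHS](_ : _ = L%:R ^+ 2 *
    (l x ^+ 2 * (a ^+ 2 * (r x * r t0 ^+ L.-1)))); last by rewrite /c; ring.
  rewrite ler_wpM2l ?sqr_ge0 //.
  apply: (@le_trans _ _ ((l x * K x) ^+ 2)).
    by rewrite exprMn ler_wpM2l ?sqr_ge0.
  rewrite lerXn2r ?nnegrE ?weighted_margin_ge //.
    by rewrite mulr_ge0 ?(ltW Kp) ?(ltW lp).
  exact/ltW/weighted_margin_gt0.
(* At this time the lower bound [c (t - t0)] for [1 / l = exp K] reaches [exp A]. *)
exists (t0 + expR A / c) => [|t Tt]; first by rewrite lerDl divr_ge0 ?expR_ge0 ?ltW.
have t0t : t0 <= t by apply: le_trans Tt; rewrite lerDl divr_ge0 ?expR_ge0 ?ltW.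
have lp : 0 < l t by apply: exp_loss_gt0.
rewrite -ler_expR; apply: (@le_trans _ _ (l t)^-1).
  apply: le_trans (h t t0t); rewrite mulrC -ler_pdivrMr //; lra.
by rewrite /K -[soft_margin _ _]opprK expRN expR_soft_margin.
Qed.

(** The soft margin is below each [q k], which is at most [C] times the norm to the power [L]; a
    small norm would therefore bound [K]. *)
Lemma sqnorm_unbounded (A : R) : exists2 T, t0 <= T & forall t, T <= t -> A <= r t.
Proof.
have [C C0 CP] := q_bound.
have [T t0T TP] := soft_margin_unbounded (C * Num.sqrt `|A| ^+ L + 1).
exists T => // t Tt; rewrite leNgt; apply/negP => rA.
have := le_trans (TP t Tt) (soft_margin_le q (W t) (Ordinal n_gt0)).
apply/negP; rewrite -ltNge.
apply: le_lt_trans (_ : C * Num.sqrt `|A| ^+ L < _); last by rewrite ltrDl.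
apply: le_trans (ler_norm _) _; apply: CP => [|c]; first exact: sqrtr_ge0.
apply: le_trans (le_sqrt_sqnorm _ _) _; apply: ler_wsqrtr.
exact: le_trans (ltW rA) (ler_norm _).
Qed.

End HomogeneousFlow.

(** * Alignment of the first layer *)

Section TwoFactorFlow.
Context {R : realType} {I : finType} {d0 d1 n k : nat}.
Variables (z : 'I_n -> 'cV[R]_d0) (u : (I -> R) -> 'cV[R]_d1).
Variable Gu : 'I_d1 -> (I -> R) -> I -> R.
Local Notation params := ('I_d0 * 'I_d1 + I -> R)%type.
Implicit Types (w : params) (i : 'I_n).

Definition first_layer w : 'M[R]_(d0, d1) := \matrix_(a, j) w (inl (a, j)).

Definition two_factor w : 'cV[R]_d0 := first_layer w *m u (w \o inr).

Definition data_margin i w : R := dotv (z i) (two_factor w).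

Definition data_margin_grad i w (c : 'I_d0 * 'I_d1 + I) : R :=
  match c with
  | inl p => z i p.1 0 * u (w \o inr) p.2 0
  | inr c' => \sum_p z i p.1 0 * w (inl p) * Gu p.2 (w \o inr) c'
  end.

Hypothesis n_gt0 : (0 < n)%N.
Hypothesis k_gt0 : (0 < k)%N.
Hypothesis u_grad : forall j, has_grad (fun x => u x j 0) (Gu j).
Hypothesis u_homog : forall a x, u (fun c => a * x c) = a ^+ k *: u x.
Hypothesis u_bound : exists2 C : R, 0 <= C & forall j x (r : R), 0 <= r ->
  (forall c, `|x c| <= r) -> `|u x j 0| <= C * r ^+ k.

Lemma data_marginE i w :
  data_margin i w = \sum_p z i p.1 0 * w (inl p) * u (w \o inr) p.2 0.
Proof.
transitivity (\sum_a \sum_j z i a 0 * w (inl (a, j)) * u (w \o inr) j 0).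
  apply: eq_bigr => a _; rewrite mxE mulr_sumr; apply: eq_bigr => j _.
  by rewrite mxE mulrA.
by rewrite pair_bigA; apply: eq_bigr => -[a j].
Qed.

Lemma data_marginP i : has_grad (data_margin i) (data_margin_grad i).
Proof.
pose Gr j w (c : 'I_d0 * 'I_d1 + I) := if c is inr c' then Gu j (w \o inr) c' else 0.
have GrP j : has_grad (fun w : params => u (w \o inr) j 0) (Gr j).
  move=> w t dw dwP; rewrite big_sumType /= big1 ?add0r => [|p _]; last first.
    by rewrite mul0r.
  exact: (u_grad j (w := fun s => w s \o inr) (dw := dw \o inr) (fun c => dwP (inr c))).
have FP := has_grad_sum (fun p : 'I_d0 * 'I_d1 =>
  has_grad_mul (has_grad_mulc (z i p.1 0) (has_grad_coord (inl p))) (GrP p.2)).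
move=> w t dw dwP.
have := FP w t dw dwP; under eq_fun do rewrite -data_marginE.
move/is_derive_eq; apply; apply: eq_bigr => c _; congr (_ * _).
case: c => [p|c] /=.
  rewrite (bigD1 p) //= eqxx mulr1 mulr0 addr0 big1 ?addr0 // => p' p'p.
  by rewrite (inj_eq inl_inj) eq_sym (negbTE p'p) !mulr0 mul0r addr0.
by apply: eq_bigr => p _; rewrite mulr0 mul0r add0r.
Qed.

Lemma data_margin_homog i a w :
  data_margin i (fun c => a * w c) = a ^+ k.+1 * data_margin i w.
Proof.
rewrite !data_marginE mulr_sumr; apply: eq_bigr => p _.
have -> : (fun c => a * w c) \o inr = (fun c => a * (w \o inr) c) by [].
by rewrite u_homog mxE exprS; ring.
Qed.

Lemma data_margin_bound : exists2 C : R, 0 <= C & forall i w (r : R), 0 <= r ->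
  (forall c, `|w c| <= r) -> `|data_margin i w| <= C * r ^+ k.+1.
Proof.
have [C C0 CP] := u_bound.
exists (\sum_i \sum_(p : 'I_d0 * 'I_d1) `|z i p.1 0| * C) => [|i w r r0 wr].
  by apply: sumr_ge0 => i _; apply: sumr_ge0 => p _; apply: mulr_ge0.
apply: (@le_trans _ _ ((\sum_(p : 'I_d0 * 'I_d1) `|z i p.1 0| * C) * r ^+ k.+1)).
  rewrite data_marginE mulr_suml; apply: le_trans (ler_norm_sum _ _ _) _.
  apply: ler_sum => p _; rewrite !normrM exprS -!mulrA ler_wpM2l //.
  by rewrite [leRHS]mulrCA ler_pM // CP // => c; apply: wr.
rewrite ler_wpM2r ?exprn_ge0 // (bigD1 i) //= lerDl.
by apply: sumr_ge0 => i' _; apply: sumr_ge0 => p _; apply: mulr_ge0.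
Qed.

Variables (W : R -> params) (t0 : R) (p : 'I_n -> R).
Let b := \sum_i p i *: z i.
Let B := dotv b b.
Hypothesis t0_gt0 : 0 < t0.
Hypothesis flow : forall c (t : R), 0 < t ->
  is_derive t 1 (fun s => W s c) (- partial_deriv (exp_loss data_margin) c (W t)).
Hypothesis loss_lt1 : exp_loss data_margin (W t0) < 1.
Hypotheses (p_ge0 : forall i, 0 <= p i) (p_sum : \sum_i p i = 1).
Hypothesis b_margin : forall i, B <= dotv b (z i).

Implicit Types (s t : R).
Let L_gt1 : (1 < k.+1)%N := k_gt0.
Let l t := exp_loss data_margin (W t).
Let K t := soft_margin data_margin (W t).
Let nu t := weighted_margin data_margin (W t).
Let r t := sqnorm (W t).
Let v t := two_factor (W t).
Let S t := \sum_i expR (- data_margin i (W t)) *: z i.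
(** The orthogonal projector onto the complement of [b]; [N] is the part of the first layer that it
    keeps and [D] the squared Frobenius norm of [N]. *)
Let Pi : 'M[R]_d0 := 1%:M - B^-1 *: (b *m b^T).
Let N t := Pi *m first_layer (W t).
Let D t := \sum_e N t e.1 e.2 ^+ 2.

(** As [b] is a convex combination of the [z i], its product with [v] is a weighted mean of the data
    margins. *)
Lemma soft_margin_le_dotv t : K t <= dotv b (v t).
Proof.
rewrite dotvC dotv_sumr -[leLHS]mul1r -p_sum mulr_suml.
apply: ler_sum => i _; rewrite dotvZr ler_wpM2l // dotvC.
exact: soft_margin_le.
Qed.

Lemma dotv_limit_gt0 t : t0 <= t -> 0 < dotv b (v t).
Proof.
move=> t0t; apply: lt_le_trans (soft_margin_le_dotv t).
exact: (soft_margin_gt0 n_gt0 data_marginP t0_gt0 flow loss_lt1).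
Qed.

(** Separability of the data, obtained from the flow: at [t0] the vector [v] has positive product
    with [b], so [b] cannot vanish. *)
Lemma limit_sqnorm_gt0 : 0 < B.
Proof.
apply: dotv_gt0; apply: contraTneq (dotv_limit_gt0 (lexx t0)) => ->.
by rewrite dotvC dotv0 ltxx.
Qed.

Let PiE (x : 'cV[R]_d0) : Pi *m x = x - (dotv b x / B) *: b.
Proof.
rewrite mulmxBl mul1mx -scalemxAl -mulmxA; congr (_ - _).
have -> : b^T *m x = (dotv b x)%:M.
  by rewrite [LHS]mx11_scalar dotvE.
by rewrite mul_mx_scalar scalerA mulrC.
Qed.

Lemma first_layer_velocity a j t : 0 < t ->
  is_derive t 1 (fun s => first_layer (W s) a j) (S t a 0 * u (W t \o inr) j 0).
Proof.
move=> tp; under eq_fun do rewrite mxE.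
apply: is_derive_eq (flow_velocity data_marginP flow (inl (a, j)) tp) _.
rewrite summxE mulr_suml; apply: eq_bigr => i _.
by rewrite mxE mulrA.
Qed.

(** The first layer moves along [S u^T], so half the derivative is [<Pi S, Pi v> = <S, v> - <b, S>
    <b, v> / B], and [<S, v>] is [nu]. *)
Lemma residual_derive t : 0 < t ->
  is_derive t 1 D (2 * (nu t - dotv b (S t) * dotv b (v t) / B)).
Proof.
move=> tp.
have dN e : is_derive t 1 (fun s => N s e.1 e.2)
    ((Pi *m S t) e.1 0 * u (W t \o inr) e.2 0).
  under eq_fun do rewrite mxE.
  apply: is_derive_eq (is_derive_bigsum _ _ (fun a =>
    is_derive_mulc (Pi e.1 a) (first_layer_velocity a e.2 tp))) _.
  by rewrite mxE mulr_suml; apply: eq_bigr => a _; rewrite mulrA.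
apply: is_derive_eq (is_derive_bigsum _ _ (fun e => is_derive_sqr (dN e))) _.
rewrite -mulr_sumr; congr (_ * _).
transitivity (dotv (Pi *m S t) (Pi *m v t)).
  rewrite -(pair_bigA _ (fun a j => N t a j *
    ((Pi *m S t) a 0 * u (W t \o inr) j 0))) /=.
  apply: eq_bigr => a _; rewrite mulmxA [(_ *m u _) a 0]mxE mulr_sumr.
  by apply: eq_bigr => j _; rewrite mulrCA.
have -> : nu t = dotv (S t) (v t).
  by rewrite dotvC dotv_sumr; apply: eq_bigr => i _; rewrite dotvZr dotvC.
rewrite !PiE !(dotvBr, dotvBl, dotvZr, dotvZl) (dotvC _ b) -/B.
by field; rewrite gt_eqF ?limit_sqnorm_gt0.
Qed.

(* Both factors of the drift of the component along b are controlled by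
   duality: <b, S> >= B l and <b, v> >= K. *)
Lemma residual_drift t : t0 <= t ->
  2 * (nu t - dotv b (S t) * dotv b (v t) / B) <= 2 * (n%:R * l t).
Proof.
move=> t0t; rewrite ler_pM2l //; have B0 := limit_sqnorm_gt0.
have bS : B * l t <= dotv b (S t).
  rewrite dotv_sumr mulr_sumr; apply: ler_sum => i _.
  by rewrite dotvZr mulrC ler_wpM2l ?expR_ge0.
have K0 : 0 < K t := soft_margin_gt0 n_gt0 data_marginP t0_gt0 flow loss_lt1 t0t.
have l0 : 0 < l t := exp_loss_gt0 _ _ n_gt0.
have : l t * K t <= dotv b (S t) * dotv b (v t) / B.
  rewrite ler_pdivlMr // mulrC mulrA ler_pM ?soft_margin_le_dotv ?(ltW K0) //.
  by rewrite mulr_ge0 ?ltW.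
have := weighted_margin_le data_margin (W t); rewrite -/(l t) -/(K t) -/(nu t).
lra.
Qed.

(** Past [T1] the bound [K >= 2 n / e] makes the drift of [D] at most that of [e / 2 * r], so [h] is
    nondecreasing. Past [T2] the other half of [e * r] absorbs the initial value [D T1]. *)
Lemma residual_small (e : R) : 0 < e ->
  exists2 T, t0 <= T & forall t, T <= t -> D t <= e * r t.
Proof.
move=> e0.
have [T1 t0T1 T1P] := soft_margin_unbounded n_gt0 L_gt1 data_marginP
  data_margin_homog t0_gt0 flow loss_lt1 (2 * n%:R / e).
have [T2 t0T2 T2P] := sqnorm_unbounded n_gt0 L_gt1 data_marginP
  data_margin_homog data_margin_bound t0_gt0 flow loss_lt1 (2 * D T1 / e).
pose h t := e / 2 * r t - D t.
have dh t : T1 <= t -> is_derive t 1 h (e / 2 * (2 * (k.+1%:R * nu t)) -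
    2 * (nu t - dotv b (S t) * dotv b (v t) / B)).
  move=> T1t; have tp : 0 < t by apply: lt_le_trans (le_trans t0T1 T1t).
  apply: is_derive_eq (is_deriveB (is_derive_mulc (e / 2)
    (sqnorm_derive data_marginP data_margin_homog flow tp)) (residual_derive tp)) _.
  by [].
have hP t : T1 <= t -> h T1 <= h t.
  apply: (le_of_derive_ge0 dh) => // x T1x.
  have t0x := le_trans t0T1 T1x.
  have := residual_drift t0x.
  have nuK : l x * K x <= nu x := weighted_margin_ge _ _.
  have l0 : 0 < l x := exp_loss_gt0 _ _ n_gt0.
  have nu0 : 0 < nu x := weighted_margin_gt0 n_gt0 data_marginP t0_gt0 flow loss_lt1 t0x.
  have eK : 2 * n%:R <= e * K x.
    by have := T1P x T1x; rewrite ler_pdivrMr // [e * _]mulrC.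
  have h1 : 2 * (n%:R * l x) <= e * nu x.
    apply: (@le_trans _ _ (e * (l x * K x))); last by rewrite ler_pM2l.
    by rewrite mulrA [l x * _]mulrC [leRHS]mulrA ler_pM2r.
  have h2 : e * nu x <= e / 2 * (2 * (k.+1%:R * nu x)).
    have -> : e / 2 * (2 * (k.+1%:R * nu x)) = k.+1%:R * (e * nu x) by field.
    by rewrite ler_peMl ?ler1n // mulr_ge0 ?ltW.
  lra.
exists (Num.max T1 T2) => [|t]; first by rewrite le_max t0T1.
rewrite ge_max => /andP[T1t T2t].
have := hP t T1t; have := T2P t T2t; rewrite ler_pdivrMr // /h.
have : 0 <= e / 2 * r T1 by rewrite mulr_ge0 ?sqnorm_ge0 // divr_ge0 // ltW.
rewrite -/(r t).
have -> : e / 2 * r t = (r t * e) / 2 by field.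
have -> : e * r t = r t * e by rewrite mulrC.
lra.
Qed.

(** The error is [- Pi v / <b, v>] with [Pi v = N u]. Here [N] is small compared with [rho] and [u]
    is at most of order [rho^k], while [<b, v> >= K >= a rho^(k+1)]. *)
Lemma two_factor_direction :
  (dotv b (v t))^-1 *: v t @[t --> +oo] --> B^-1 *: b.
Proof.
have [C C0 CP] := u_bound.
have [a a0 aP] := soft_margin_growth n_gt0 L_gt1 data_marginP
  data_margin_homog t0_gt0 flow loss_lt1.
apply: cvg_col => i; apply/cvgrPdist_le => e e0.
(* The added 1 keeps [C1] positive when [d1] or [C] is zero; [dl] is then chosen so that
   [d1 * dl * C <= e * a]. *)
pose C1 := d1%:R * C + 1.
have C10 : 0 < C1 by rewrite ltr_pwDr // mulr_ge0.
pose dl := e * a / C1.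
have dl0 : 0 < dl by rewrite divr_gt0 // mulr_gt0.
have [T t0T TP] := residual_small (exprn_gt0 2 dl0).
exists T; split; first exact: num_real.
move=> t /ltW Tt; have t0t := le_trans t0T Tt.
have bv0 := dotv_limit_gt0 t0t.
have B0 := limit_sqnorm_gt0.
set rho := Num.sqrt (r t).
have rho0 : 0 <= rho := sqrtr_ge0 _.
have r0 : 0 <= r t := sqnorm_ge0 _.
have sqrtD : Num.sqrt (D t) <= dl * rho.
  rewrite -(ger0_norm (ltW dl0)) -sqrtr_sqr -sqrtrM ?sqr_ge0 // ler_wsqrtr //.
  exact: TP.
have Nle a' j : `|N t a' j| <= dl * rho.
  apply: le_trans sqrtD; rewrite -sqrtr_sqr ler_wsqrtr //.
  rewrite /D (bigD1 (a', j)) //= lerDl.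
  by apply: sumr_ge0 => ? _; apply: sqr_ge0.
have Piv : `|(Pi *m v t) i 0| <= e * dotv b (v t).
  apply: (@le_trans _ _ (d1%:R * (dl * rho * (C * rho ^+ k)))).
    rewrite mulmxA mxE; apply: le_trans (ler_norm_sum _ _ _) _.
    have -> : d1%:R * (dl * rho * (C * rho ^+ k)) =
        \sum_(j < d1) dl * rho * (C * rho ^+ k).
      by rewrite sumr_const card_ord mulr_natl.
    apply: ler_sum => j _; rewrite normrM ler_pM //.
    by apply: CP => // c; apply: (le_sqrt_sqnorm (W t) (inr c)).
  apply: (@le_trans _ _ (e * (a * rho ^+ k.+1))); last first.
    by rewrite ler_pM2l // (le_trans (aP t t0t)) // soft_margin_le_dotv.
  have -> : d1%:R * (dl * rho * (C * rho ^+ k)) =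
      e * (a * rho ^+ k.+1) * ((d1%:R * C) / C1).
    by rewrite exprS /dl; field; rewrite gt_eqF.
  rewrite ler_piMr //; last by rewrite ler_pdivrMr // mul1r lerDl.
  by rewrite mulr_ge0 ?(ltW e0) // mulr_ge0 ?(ltW a0) // exprn_ge0.
have -> : (B^-1 *: b) i 0 - ((dotv b (v t))^-1 *: v t) i 0 =
    - ((dotv b (v t))^-1 * (Pi *m v t) i 0).
  by rewrite PiE !mxE; field; rewrite !gt_eqF.
by rewrite normrN normrM gtr0_norm ?invr_gt0 // mulrC ler_pdivrMr.
Qed.

End TwoFactorFlow.

(** * Group averages and the steerable network *)

Section GroupAverage.
Context {R : realType} {gT : finGroupType} {d : nat}.
Variable rho0 : mx_representation R [set: gT]%SET d.
Let A := group_avg rho0.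

Lemma card_group_neq0 : #|gT|%:R != 0 :> R.
Proof. by rewrite pnatr_eq0 -lt0n; apply/card_gt0P; exists 1%g. Qed.

Lemma avg_vecE (v : 'cV[R]_d) : avg_vec rho0 v = A *m v.
Proof. by rewrite /A /group_avg -scalemxAl mulmx_suml. Qed.

Lemma avg_tr_vecE (v : 'cV[R]_d) : avg_tr_vec rho0 v = A^T *m v.
Proof. by rewrite /A /group_avg linearZ -scalemxAl linear_sum mulmx_suml. Qed.

Lemma group_avg_repr g : A *m rho0 g = A.
Proof.
rewrite -scalemxAl mulmx_suml; congr (_ *: _).
rewrite [RHS](reindex_inj (mulIg g)) /=; apply: eq_bigr => h _.
by rewrite repr_mxM ?inE.
Qed.

Lemma group_avg_idem : A *m A = A.
Proof.
rewrite {2}/A /group_avg -scalemxAr mulmx_sumr.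
rewrite (eq_bigr (fun=> A)) => [|g _]; last exact: group_avg_repr.
by rewrite sumr_const -[X in _ *: X]scaler_nat scalerA mulVf ?scale1r ?card_group_neq0.
Qed.

(** Averaging the invariance over the group gives [<v, w> = <v, A w>]; conversely [A *m rho0 g = A]
    makes every vector in the range of [A^T] invariant. *)
Lemma invariant_predictorsP (v : 'cV[R]_d) :
  invariant_predictors rho0 v <-> A^T *m v = v.
Proof.
split=> [vinv|vA w g]; last first.
  by rewrite -vA !dotv_mulmx trmxK mulmxA group_avg_repr.
have h w : dotv v w = dotv v (A *m w).
  rewrite -scalemxAl dotvZr mulmx_suml dotv_sumr (eq_bigr (fun=> dotv v w)) => [|g _].
    by rewrite sumr_const -[X in _ * X]mulr_natl mulrA mulVf ?mul1r ?card_group_neq0.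
  by rewrite -vinv.
apply/eqP; rewrite -subr_eq0; apply/eqP/dotv_eq0.
by rewrite {1}dotvBl dotv_mulmx trmxK -h subrr.
Qed.

Lemma unitary_group_avg : unitary_repr rho0 -> A^T = A.
Proof.
move=> un; rewrite /A /group_avg linearZ linear_sum; congr (_ *: _).
rewrite [RHS](reindex_inj invg_inj) /=.
by apply: eq_bigr => g _; rewrite un.
Qed.

End GroupAverage.

(** * The steerable network as a two-factor model *)

Section SteerableNetwork.
Context {R : realType} {gT : finGroupType} {d0 d1 k : nat}.
Variable rho0 : mx_representation R [set: gT]%SET d0.
Variable net : upper_layers k (regular_rep R gT d1).

(** By invariance the upper layers see a lifted input only through its group mean, a vector of
    [R^d1]; this is the vector representing that linear functional. *)
Definition const_response (w : weight_idx net -> R) : 'cV[R]_d1 :=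
  \col_j upper_eval w ([ffun=> delta_mx j 0] : rep_space (regular_rep R gT d1)).

(** The group mean of the lifting of [x] is [w_1^T A x], because inversion permutes the group; [A]
    and [w_1] are then moved to the other side of the inner product. *)
Lemma P_steerE (W : param_idx d0 net -> R) :
  P_steer rho0 W = (group_avg rho0)^T *m two_factor const_response W.
Proof.
have h v : dotv v (P_steer rho0 W) =
    dotv v ((group_avg rho0)^T *m two_factor const_response W).
  rewrite -f_steerE /f_steer upper_eval_regular.
  transitivity (dotv ((first_layer W)^T *m (group_avg rho0 *m v))
    (const_response (W \o inr))); last first.
    by rewrite dotv_mulmx trmxK dotv_mulmx.
  apply: eq_bigr => j _; rewrite [X in _ = _ * X]mxE; congr (_ * _).
  congr (fun_of_matrix _ j 0); rewrite /group_avg -scalemxAl -scalemxAr; congr (_ *: _).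
  rewrite mulmx_suml mulmx_sumr [RHS](reindex_inj invg_inj) /=.
  by apply: eq_bigr => g _; rewrite ffunE repr_mxV ?inE.
apply/eqP; rewrite -subr_eq0; apply/eqP/dotv_eq0.
by rewrite dotvBr h subrr.
Qed.

Lemma const_response_grad :
  exists Gu : 'I_d1 -> (weight_idx net -> R) -> weight_idx net -> R, forall j, has_grad (fun w => const_response w j 0) (Gu j).
Proof.
suff /choice[Gu GuP] : forall j, exists Gj, has_grad (fun w => const_response w j 0) Gj.
  by exists Gu.
move=> j.
have [G GP] := upper_eval_grad net
  ([ffun=> delta_mx j 0] : rep_space (regular_rep R gT d1)).
by exists G; apply: has_grad_eq GP => w; rewrite mxE.
Qed.

Lemma const_response_homog a (w : weight_idx net -> R) :
  const_response (fun c => a * w c) = a ^+ k *: const_response w.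
Proof. by apply/colP => j; rewrite !mxE upper_eval_scale. Qed.

Lemma const_response_bound : exists2 C : R, 0 <= C &
  forall j (w : weight_idx net -> R) (r : R), 0 <= r ->
  (forall c, `|w c| <= r) -> `|const_response w j 0| <= C * r ^+ k.
Proof.
have /choice[C CP] : forall j : 'I_d1, exists C : R, 0 <= C /\
    forall (w : weight_idx net -> R) (r : R), 0 <= r ->
    (forall c, `|w c| <= r) -> `|const_response w j 0| <= C * r ^+ k.
  move=> j.
  have [C C0 CP] := upper_eval_bound net
    ([ffun=> delta_mx j 0] : rep_space (regular_rep R gT d1)).
  by exists C; split => // w r r0 wr; rewrite mxE CP.
exists (\sum_j C j) => [|j w r r0 wr].
  by apply: sumr_ge0 => j _; have [] := CP j.
have [_ Cj] := CP j; apply: le_trans (Cj w r r0 wr) _.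
rewrite ler_wpM2r ?exprn_ge0 // (bigD1 j) //= lerDl.
by apply: sumr_ge0 => j' _; have [] := CP j'.
Qed.

End SteerableNetwork.

(* Weak duality with a quadratic gap, which also yields uniqueness. *)
Lemma svm_gap (R : realType) (d n : nat) (z : 'I_n -> 'cV[R]_d) (p : 'I_n -> R)
    (v : 'cV[R]_d) :
  let b := \sum_i p i *: z i in let gam := (dotv b b)^-1 *: b in
  (forall i, 0 <= p i) -> \sum_i p i = 1 -> 0 < dotv b b ->
  (forall i, 1 <= dotv (z i) v) ->
  dotv (v - gam) (v - gam) <= dotv v v - dotv gam gam.
Proof.
move=> b gam p0 p1 B0 zv.
have bv : 1 <= dotv v b.
  rewrite dotv_sumr -p1; apply: ler_sum => i _.
  by rewrite dotvZr ler_peMr // dotvC.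
rewrite !(dotvBr, dotvBl) !(dotvZr, dotvZl) (dotvC b v).
set B := dotv b b in B0 *.
have BB : B^-1 * (B^-1 * B) = B^-1 by rewrite mulVf ?mulr1 ?gt_eqF.
rewrite BB; have : B^-1 <= B^-1 * dotv v b.
  by rewrite ler_peMr // invr_ge0 ltW.
lra.
Qed.

Theorem theorem4p1 (R : realType) (gT : finGroupType) (d0 d1 L n : nat)
    (rho0 : mx_representation R [set: gT]%SET d0)
    (hL : (2 <= L)%N)
    (net : upper_layers L.-1 (regular_rep R gT d1))
    (hn : (0 < n)%N)
    (x : 'I_n -> 'cV[R]_d0) (y : 'I_n -> R)
    (hy : forall i, y i = 1 \/ y i = -1)
    (W : R -> param_idx d0 net -> R)
    (hW : gradient_flow (loss_steer rho0 x y) W)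
    (t0 : R) (ht0 : 0 < t0)
    (hloss : loss_steer rho0 x y (W t0) < 1) :
  let beta t := P_steer rho0 (W t) in
  let xbar i := avg_vec rho0 (x i) in
  exists binf gam bstar : 'cV[R]_d0,
  (* part (a) *)
  [/\ (norm2 (beta t))^-1 *: beta t @[t --> +oo] --> binf,
      is_unique_argmin (fun v => norm2 v ^+ 2) (feasible xbar y) gam,
      propto binf (avg_tr_vec rho0 gam) &
      unitary_repr rho0 -> propto binf gam]
  /\
  (* part (b) *)
  [/\ is_unique_argmin
        (fun b => norm2 (orth_proj_range (group_avg rho0) b) ^+ 2)
        (invariant_predictors rho0 `&` feasible x y) bstar,
      propto binf bstar &
      unitary_repr rho0 ->
        [/\ is_unique_argmin (fun b => norm2 b ^+ 2)
              (invariant_predictors rho0 `&` feasible x y) bstar,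
            invariant_predictors rho0 binf &
            forall b, invariant_predictors rho0 b -> b != 0 ->
              l2_margin x y b <= l2_margin x y binf]].
Proof.
move=> beta xbar; set A := group_avg rho0.
pose z i := y i *: (A *m x i).
pose u := const_response (net := net).
pose v t := two_factor u (W t).
have AA : A *m A = A := group_avg_idem rho0.
have zE i w : dotv (z i) w = y i * dotv (x i) (A^T *m w).
  by rewrite dotvZl dotv_mulmx.
have xbarE i w : y i * dotv (xbar i) w = dotv (z i) w.
  by rewrite /xbar avg_vecE dotvZl.
have lossE : loss_steer rho0 x y = exp_loss (data_margin z u).
  apply/funext => w; apply: eq_bigr => i _; congr expR; congr (- _).
  by rewrite /data_margin zE P_steerE mulrC.
have [Gu GuP] := const_response_grad net.
have uh := const_response_homog (net := net).
have ub := const_response_bound net.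
have L1 : (0 < L.-1)%N by rewrite -ltnS (ltn_predK hL).
have flow c (t : R) : 0 < t -> is_derive t 1 (fun s => W s c)
    (- partial_deriv (exp_loss (data_margin z u)) c (W t)).
  by rewrite -lossE; apply: hW.2.
have loss1 : exp_loss (data_margin z u) (W t0) < 1 by rewrite -lossE.
have [p] := min_norm_point z hn; set b := \sum_i _ => -[p0 p1 bz].
have vlim : (dotv b (v t))^-1 *: v t @[t --> +oo] --> (dotv b b)^-1 *: b :=
  two_factor_direction hn L1 GuP uh ub ht0 flow loss1 p0 p1 bz.
have bv0 t : t0 <= t -> 0 < dotv b (v t) :=
  dotv_limit_gt0 hn GuP ht0 flow loss1 p0 p1 (t := t).
have B0 : 0 < dotv b b := limit_sqnorm_gt0 hn GuP ht0 flow loss1 p0 p1.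
pose gam := (dotv b b)^-1 *: b.
have gap w : (forall i, 1 <= dotv (z i) w) ->
    dotv (w - gam) (w - gam) <= dotv w w - dotv gam gam := svm_gap p0 p1 B0 (v := w).
(* The scaling by [1 / |b|^2] turns [<b, z i> >= |b|^2] into margin at least 1. *)
have gam_feas i : 1 <= dotv (z i) gam.
  by rewrite dotvZr mulrC ler_pdivlMr // mul1r dotvC.
(* Each [z i] lies in the range of the idempotent [A], hence so does [b]. *)
have Ab : A *m b = b.
  rewrite mulmx_sumr; apply: eq_bigr => i _.
  by rewrite -!scalemxAr mulmxA AA.
have Agam : A *m gam = gam by rewrite -scalemxAr Ab.
pose bstar := A^T *m gam.
have bstar_feas i : 1 <= y i * dotv (x i) bstar by rewrite -zE.
have bstar0 : bstar != 0.
  apply: contraTneq (bstar_feas (Ordinal hn)) => ->.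
  by rewrite dotv0 mulr0 -ltNge ltr01.
have nb0 : 0 < (norm2 bstar)^-1 by rewrite invr_gt0 norm2_gt0.
pose binf := (norm2 bstar)^-1 *: bstar.
have bstar_inv : invariant_predictors rho0 bstar.
  by apply/invariant_predictorsP; rewrite mulmxA -trmx_mul AA.
have svm : is_unique_argmin (fun w => norm2 w ^+ 2) (feasible xbar y) gam.
  have gamF : feasible xbar y gam by move=> i; rewrite xbarE.
  have min w : feasible xbar y w -> dotv (w - gam) (w - gam) <= dotv w w - dotv gam gam.
    by move=> wF; apply: gap => i; rewrite -xbarE.
  split; first split => // w wF; rewrite ?norm2_sqr.
    by rewrite -subr_ge0 (le_trans (dotv_ge0 _) (min w wF)).
  move=> w [wF wmin]; apply/eqP; rewrite -subr_eq0; apply/eqP/dotv_eq0/le_anti.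
  rewrite dotv_ge0 andbT; apply: le_trans (min w wF) _.
  by rewrite subr_le0 -!norm2_sqr wmin.
have un_bstar : unitary_repr rho0 -> bstar = gam.
  by move=> un; rewrite /bstar unitary_group_avg.
have feasE w : invariant_predictors rho0 w ->
    feasible x y w <-> feasible xbar y w.
  move=> /invariant_predictorsP wA.
  by split => wF i; have := wF i; rewrite xbarE zE wA.
exists binf, gam, bstar; split; split => //.
(* Normalization forgets the factor [<b, v>], positive from [t0] on, so the limit of [v / <b, v>]
   passes to [beta = A^T v]. *)
- have h : (norm2 (A^T *m ((dotv b (v t))^-1 *: v t)))^-1 *:
      (A^T *m ((dotv b (v t))^-1 *: v t)) @[t --> +oo] --> binf.
    by apply: cvg_normalize => //; apply: cvg_mulmx.
  apply: cvg_trans h; apply: near_eq_cvg; exists t0; split; first exact: num_real.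
  move=> t /ltW t0t; rewrite /beta P_steerE -/u -/(v t) -/A -scalemxAr.
  by rewrite normalize_scale // invr_gt0 bv0.
- by exists (norm2 bstar)^-1 => //; rewrite avg_tr_vecE.
- by move=> un; exists (norm2 bstar)^-1 => //; rewrite -un_bstar.
- have projE w : exists w', orth_proj_range A w = A *m w' /\
      forall w'', dotv (w - orth_proj_range A w) (A *m w'') = 0.
    by have [[w' ?] ?] := (orth_proj_range_unique A w _).2 erefl; exists w'.
  (* [A^T] annihilates the part of [w] orthogonal to the range of [A]. *)
  have trproj w : A^T *m orth_proj_range A w = A^T *m w.
    have [w' [_ orth]] := projE w.
    apply/eqP; rewrite eq_sym -subr_eq0 -mulmxBr; apply/eqP/dotv_eq0.
    by rewrite {1}dotv_mulmx trmxK orth.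
  (* [gam] is in the range of [A], and [<A^T gam, A w> = <gam, A w>] because [A] is idempotent. *)
  have pbstar : orth_proj_range A bstar = gam.
    apply/esym/(orth_proj_range_unique A bstar gam).1; split; first by exists gam.
    move=> w; rewrite dotvBl dotv_mulmx trmxK mulmxA AA subrr //.
  have proj_feas w : invariant_predictors rho0 w -> feasible x y w ->
      feasible xbar y (orth_proj_range A w).
    move=> /invariant_predictorsP wA wF i.
    by rewrite xbarE zE trproj wA.
  split; first split => // w [winv wF].
    by rewrite pbstar; apply: svm.1.2; apply: proj_feas.
  (* The projection of a minimizer solves the SVM problem, hence is [gam]; invariance recovers [w]
     as [A^T] applied to its projection. *)
  move=> w [[winv wF] wmin].
  have /svm.2 pw : is_argmin (fun w => norm2 w ^+ 2) (feasible xbar y)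
      (orth_proj_range A w).
    split; first exact: proj_feas.
    move=> w' w'F; apply: le_trans (svm.1.2 _ w'F); rewrite -pbstar.
    by apply: wmin.
  by rewrite /bstar -pw trproj; apply/esym/invariant_predictorsP.
- by exists (norm2 bstar)^-1.
- move=> un; have bg := un_bstar un; split.
  + rewrite bg; split.
      split=> [|w [winv wF]].
        by split; [rewrite -bg | move=> i; rewrite -bg].
      by apply: svm.1.2; apply/feasE.
    move=> w [[winv wF] wmin]; apply: svm.2; split; first exact/feasE.
    move=> w' w'F; apply: le_trans (svm.1.2 _ w'F).
    by rewrite -bg; apply: wmin; split.
  + by apply/invariant_predictorsP; rewrite -scalemxAr (invariant_predictorsP _ _).1.
  + move=> w winv w0.
    have ng : 0 < norm2 gam by rewrite -bg norm2_gt0.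
    have nw : 0 < norm2 w := norm2_gt0 w0.
    have inf_le i : l2_margin x y w <= y i * dotv (x i) w / norm2 w.
      apply: ge_inf; last by exists i.
      exists (\big[Num.min/0]_i (y i * dotv (x i) w / norm2 w)) => _ [j _ <-].
      exact: bigmin_le_cond.
    have hi : (norm2 gam)^-1 <= l2_margin x y binf.
      apply: lb_le_inf => [|_ [j _ <-]].
        by eexists; exists (Ordinal hn).
      rewrite [norm2 binf]norm2Z ?(ltW nb0) // mulVf ?gt_eqF ?norm2_gt0 //.
      rewrite divr1 dotvZr mulrCA -bg ler_peMr ?(ltW nb0) //.
    apply: le_trans hi; set m := l2_margin x y w.
    have [m0|m0] := leP m 0; first by rewrite (le_trans m0) // invr_ge0 ltW.
    (* A predictor with positive margin [m], rescaled to be feasible, has norm [1 / m], so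
       minimality of [gam] gives [|gam| <= 1 / m]. *)
    pose w' := (m * norm2 w)^-1 *: w.
    have mw : 0 < m * norm2 w by rewrite mulr_gt0.
    have w'inv : invariant_predictors rho0 w'.
      by apply/invariant_predictorsP; rewrite -scalemxAr (invariant_predictorsP _ _).1.
    have w'F : feasible x y w'.
      move=> i; rewrite dotvZr mulrCA mulrC ler_pdivlMr // mul1r.
      by have := inf_le i; rewrite ler_pdivlMr.
    have : norm2 gam ^+ 2 <= norm2 w' ^+ 2 := svm.1.2 w' ((feasE _ w'inv).1 w'F).
    rewrite ler_pXn2r ?nnegrE ?sqrtr_ge0 // [norm2 w']norm2Z ?invr_ge0 ?(ltW mw) //.
    rewrite invfM -mulrA mulVf ?gt_eqF // mulr1 => h.
    by rewrite -[m]invrK lef_pV2 ?posrE ?invr_gt0.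
Qed.
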